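(* Let $\mathcal{V}=\{1,\dots,N\}$ and let $\mathcal{E}\subset\mathcal{V}\times\mathcal{V}$ be the edge set of a strongly connected graph with $(i,i)\in\mathcal{E}$ for all $i\in\mathcal{V}$; put $\mathcal{N}_i=\{j:(i,j)\in\mathcal{E}\}$. Let $D^i\in\mathbb{R}^{n\times n}$ for $i\in\mathcal{V}$, and suppose the largest eigenvalue of $\mathcal{A}^\dagger\big(\sum_{i=1}^N D^i\big)$ has multiplicity $1$, so that the problem $$\text{maximize}\ \sum_{i=1}^N\langle\mathcal{A}^\dagger(D^i),Z^i\rangle\quad\text{s.t. } Z^i\in\mathcal{F}\ \ \forall i\in\mathcal{V},\quad Z^i=Z^j\ \ \forall (i,j)\in\mathcal{E}$$ has a unique global optimizer $Z^1=\dots=Z^N=Z^*$. Consider the following two algorithms, where all dual matrices $Y$ are symmetric and $\alpha>0$ is a parameter. (a) (Completely distributed ADMM, for the equivalent problem of maximizing $\sum_{i=1}^N\langle\mathcal{A}^\dagger(D^i),Z^i\rangle$ subject to $Z^i\in\mathcal{F}$ for all $i\in\mathcal{V}$, $X^j\in\mathcal{F}$ for all $j\in\mathcal{V}$, and $Z^i=X^j$ for all $(i,j)\in\mathcal{E}$.) $$Z^i_{t+1}=\underset{Z^i\in\mathcal{F}}{\arg\max}\ \langle M^i_t,Z^i\rangle-\tfrac{|\mathcal{N}_i|\alpha}{2}\|Z^i\|_F^2,\qquad X^j_{t+1}=\underset{X^j\in\mathcal{F}}{\arg\max}\ \langle N^j_t,X^j\rangle-\tfrac{|\mathcal{N}_j|\alpha}{2}\|X^j\|_F^2,$$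 $$Y^{ij}_{t+1}=Y^{ij}_t-\alpha(X^j_{t+1}-Z^i_{t+1}),$$ where $M^i_t=\mathcal{A}^\dagger(D^i)-\sum_{j:(i,j)\in\mathcal{E}}[Y^{ij}_t-\alpha X^j_t]$ and $N^j_t=\sum_{i:(j,i)\in\mathcal{E}}[Y^{ij}_t+\alpha Z^i_{t+1}]$, and the $Y$ update is performed for every pair $(i,j)$ for which $Y^{ij}$ appears in these formulas. (b) (Semi-distributed ADMM, for the equivalent problem with a fusion variable $Z^0$ of maximizing $\sum_{i=1}^N\langle\mathcal{A}^\dagger(D^i),Z^i\rangle$ subject to $Z^i\in\mathcal{F}$ for all $i\in\mathcal{V}\cup\{0\}$ and $Z^i=Z^0$ for all $i\in\mathcal{V}$.) $$Z^i_{t+1}=\underset{Z^i\in\mathcal{F}}{\arg\max}\ \langle\mathcal{A}^\dagger(D^i)-Y^i_t+\alpha Z^0_t,Z^i\rangle-\tfrac{\alpha}{2}\|Z^i\|_F^2\quad(i\in\mathcal{V}),$$ $$Z^0_{t+1}=\underset{Z^0\in\mathcal{F}}{\arg\max}\ \Big\langle\sum_{i=1}^N(Y^i_t+\alpha Z^i_{t+1}),Z^0\Big\rangle-\tfrac{\alpha}{2}\|Z^0\|_F^2,\qquad Y^i_{t+1}=Y^i_t-\alpha(Z^0_{t+1}-Z^i_{t+1})\quad(i\in\mathcal{V}).$$ Then the objectives are closed, proper and convex (being linear), and, strong duality holding, the unaugmented Lagrangian has a saddle point; thus each algorithm is guaranteed to converge for an appropriately chosen parameter $\alpha$: the objective value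 of its iterates converges to the optimal value. Further, as the global optimizer is unique and the objective functions are continuous, the iterates converge to the optimal solution, i.e. in (a) $Z^i_t\to Z^*$ and $X^j_t\to Z^*$ for all $i,j\in\mathcal{V}$, and in (b) $Z^i_t\to Z^*$ for all $i\in\mathcal{V}\cup\{0\}$. The consensus point $\mathcal{A}(Z^* )$ is an element of $SO(n)$.
   Context: $SO(n)=\{R\in\mathbb{R}^{n\times n}: R^\top R=I,\ \det R=1\}$, $\mathrm{conv}$ denotes convex hull, $\langle A,B\rangle=\mathrm{trace}(A^\top B)$, $\|A\|_F^2=\langle A,A\rangle$, and $\mathbb{S}^m$ is the space of real symmetric $m\times m$ matrices. $\mathcal{F}=\{Z\in\mathbb{S}^{2^{n-1}}: Z\succeq0,\ \mathrm{trace}(Z)=1\}$ is the free spectrahedron. ADMM stands for the alternating direction method of multipliers. Put $I_2=\begin{bmatrix}1&0\\0&1\end{bmatrix}$, $\sigma=\begin{bmatrix}1&0\\0&-1\end{bmatrix}$, $J=\begin{bmatrix}0&-1\\1&0\end{bmatrix}$. For $1\le i\le n$ define the $2^n\times2^n$ matrices $$\lambda_i=\sigma^{\otimes(i-1)}\otimes J\otimes I_2^{\otimes(n-i)},\qquad \rho_i=I_2^{\otimes(i-1)}\otimes J\otimes\sigma^{\otimes(n-i)},$$ and the $2^n\times 2^{n-1}$ matrix $$P_{\mathrm{even}}=\frac12\begin{bmatrix}I+\sigma^{\otimes(n-1)}\\ I-\sigma^{\otimes(n-1)}\end{bmatrix},$$ with $I$ the identity of size $2^{n-1}$. Let $A_{ij}=-P_{\mathrm{even}}^\top\lambda_i\rho_jP_{\mathrm{even}}\in\mathbb{S}^{2^{n-1}}$.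 Define $\mathcal{A}:\mathbb{S}^{2^{n-1}}\to\mathbb{R}^{n\times n}$ by $\mathcal{A}(Z)_{ij}=\langle A_{ij},Z\rangle$, and $\mathcal{A}^\dagger(Y)=\sum_{i,j}A_{ij}Y_{ij}$, its adjoint. Known fact (Saunderson, Parrilo, Willsky), which may be used: $\mathrm{conv}(SO(n))=\{\mathcal{A}(Z): Z\in\mathcal{F}\}$.
   Formalization: Convergence of (a) is proved only for undirected E, i.e. (i,j) in E implies (j,i) in E; for directed strongly connected E the displayed updates can stay constant at any point of F for every alpha, so the claim fails there. *)

(* Defs.v *)
From HB Require Import structures.
From mathcomp Require Import all_boot all_order all_algebra.
From mathcomp Require Import all_classical all_reals all_analysis.
From mathcomp Require Import mxtens.

Set Implicit Arguments.
Unset Strict Implicit.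
Unset Printing Implicit Defensive.

Import Order.TTheory GRing.Theory Num.Theory.
Import numFieldNormedType.Exports.

Local Open Scope classical_set_scope.
Local Open Scope ring_scope.

Section Optimization.
Variable R : realType.

Definition argmax (T : Type) (S : set T) (f : T -> R) : set T :=
  [set x | S x /\ forall y, S y -> f y <= f x].

(* Closed, proper and convex are meant for extended-valued functions that are
   to be minimized: the epigraph is closed, the value -oo is never taken and
   +oo is not the only value, the epigraph is convex. *)
Definition closed_function (T : topologicalType) (f : T -> \bar R) : Prop :=
  closed [set p : T * R | (f p.1 <= (p.2)%:E)%E].

Definition proper_function (T : Type) (f : T -> \bar R) : Prop :=
  (forall x, f x != -oo%E) /\ (exists x, (f x < +oo)%E).

Definition convex_efunction (E : lmodType R) (f : E -> \bar R) : Prop :=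
  @convex_set R (E * R^o)%type [set p : E * R^o | (f p.1 <= (p.2)%:E)%E].

(* The function to be minimized when f is maximized over S. *)
Definition restricted_neg (T : Type) (S : set T) (f : T -> R) (x : T) : \bar R :=
  if x \in S then (- f x)%:E else +oo%E.

Definition closed_proper_convex_mx d (f : 'M[R]_d -> \bar R) : Prop :=
  [/\ closed_function f, proper_function f & convex_efunction f].

(* For a finite index set, {ptws _ -> _} carries the product topology. *)
Definition closed_proper_convex_family d N
    (f : ('I_N -> 'M[R]_d) -> \bar R) : Prop :=
  [/\ closed_function (f : {ptws 'I_N -> 'M[R]_d} -> \bar R),
      proper_function f & convex_efunction f].

(* Saddle point of L, maximized in the primal variable over P and minimized in
   the dual variable over Q. *)
Definition saddle_point (T U : Type) (P : set T) (Q : set U)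
    (L : T -> U -> R) (x : T) (y : U) : Prop :=
  [/\ P x, Q y, forall x', P x' -> L x' y <= L x y
    & forall y', Q y' -> L x y <= L x y'].

(* The dual optimal value of L equals the optimal value of f over the feasible
   set S. *)
Definition strong_duality (T U : Type) (P : set T) (Q : set U)
    (L : T -> U -> R) (S : set T) (f : T -> R) : Prop :=
  ereal_inf [set ereal_sup [set (L x y)%:E | x in P] | y in Q]
  = ereal_sup [set (f x)%:E | x in S].

End Optimization.

Section Matrices.
Variable R : realType.

Definition frob p q (A B : 'M[R]_(p, q)) : R := \tr (A^T *m B).

Definition symmetric_mx d : set 'M[R]_d := [set A | A^T = A].

Definition free_spectrahedron d : set 'M[R]_d :=
  [set Z | [/\ symmetric_mx Z,
               forall x : 'cV[R]_d, 0 <= (x^T *m Z *m x) 0 0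
             & \tr Z = 1]].

Definition special_orthogonal n : set 'M[R]_n :=
  [set Q | Q^T *m Q = 1%:M /\ \det Q = 1].

Definition convex_hull (E : lmodType R) (S : set E) : set E :=
  [set x | exists k (w : 'I_k -> R) (s : 'I_k -> E),
     [/\ forall i, 0 <= w i, \sum_i w i = 1, forall i, S (s i)
       & x = \sum_i w i *: s i]].

(* For a symmetric matrix, geometric and algebraic multiplicities agree. *)
Definition simple_largest_eigenvalue d (A : 'M[R]_d) : Prop :=
  exists a, [/\ eigenvalue A a, forall b, eigenvalue A b -> b <= a
              & \rank (eigenspace A a) = 1%N].

Definition sigma2 : 'M[R]_2 := delta_mx 0 0 - delta_mx 1 1.

Definition J2 : 'M[R]_2 := delta_mx 1 0 - delta_mx 0 1.

Fact tens_at_dim n (i : 'I_n) : (2 ^ i * (2 * 2 ^ (n - i.+1)) = 2 ^ n)%N.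
Proof. by rewrite -expnS -expnD -subSn ?ltn_ord // subSS subnKC // ltnW. Qed.

(* A (x) ... (x) A (x) B (x) C (x) ... (x) C, with n factors, the factor B
   preceded by i copies of A. *)
Definition tens_at n (A B C : 'M[R]_2) (i : 'I_n) : 'M[R]_(2 ^ n) :=
  castmx (tens_at_dim i, tens_at_dim i) (A ^t i *t (B *t C ^t (n - i.+1))).

Definition lambda_mx n (i : 'I_n) : 'M[R]_(2 ^ n) := tens_at sigma2 J2 1%:M i.

Definition rho_mx n (i : 'I_n) : 'M[R]_(2 ^ n) := tens_at 1%:M J2 sigma2 i.

Fact even_dim m : (2 ^ m + 2 ^ m = 2 ^ m.+1)%N.
Proof. by rewrite expnS mul2n addnn. Qed.

(* From here on the rotations have size m.+1, so that m stands for n - 1. *)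
Definition Peven m : 'M[R]_(2 ^ m.+1, 2 ^ m) :=
  castmx (even_dim m, erefl)
    (2^-1 *: col_mx (1%:M + sigma2 ^t m) (1%:M - sigma2 ^t m)).

Definition Amx m (i j : 'I_m.+1) : 'M[R]_(2 ^ m) :=
  - ((Peven m)^T *m lambda_mx i *m rho_mx j *m Peven m).

Definition Amap m (Z : 'M[R]_(2 ^ m)) : 'M[R]_m.+1 :=
  \matrix_(i, j) frob (Amx i j) Z.

Definition Aadj m (Y : 'M[R]_m.+1) : 'M[R]_(2 ^ m) :=
  \sum_i \sum_j Y i j *: Amx i j.

End Matrices.

Section Consensus.
Variables (R : realType) (m N : nat) (e : rel 'I_N) (D : 'I_N -> 'M[R]_m.+1).

Local Notation M := 'M[R]_(2 ^ m).
Local Notation F := (@free_spectrahedron R (2 ^ m)).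

Definition F_family : set ('I_N -> M) := [set Z | forall i, F (Z i)].

Definition objective (Z : 'I_N -> M) : R := \sum_i frob (Aadj (D i)) (Z i).

Definition consensus_feasible : set ('I_N -> M) :=
  [set Z | F_family Z /\ forall i j, e i j -> Z i = Z j].

(* Reformulation with copies X: primal variables (Z, X). *)
Definition split_domain : set (('I_N -> M) * ('I_N -> M)) :=
  [set p | F_family p.1 /\ F_family p.2].

Definition split_feasible : set (('I_N -> M) * ('I_N -> M)) :=
  [set p | split_domain p /\ forall i j, e i j -> p.1 i = p.2 j].

Definition split_objective (p : ('I_N -> M) * ('I_N -> M)) : R :=
  objective p.1.

Definition split_dual : set ('I_N -> 'I_N -> M) :=
  [set Y | forall i j, symmetric_mx (Y i j)].

Definition split_lagrangian (p : ('I_N -> M) * ('I_N -> M))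
    (Y : 'I_N -> 'I_N -> M) : R :=
  split_objective p + \sum_i \sum_(j | e i j) frob (Y i j) (p.2 j - p.1 i).

(* Reformulation with a fusion variable: primal variables (Z, Z0). *)
Definition fusion_domain : set (('I_N -> M) * M) :=
  [set p | F_family p.1 /\ F p.2].

Definition fusion_feasible : set (('I_N -> M) * M) :=
  [set p | fusion_domain p /\ forall i, p.1 i = p.2].

Definition fusion_objective (p : ('I_N -> M) * M) : R := objective p.1.

Definition fusion_dual : set ('I_N -> M) :=
  [set Y | forall i, symmetric_mx (Y i)].

Definition fusion_lagrangian (p : ('I_N -> M) * M) (Y : 'I_N -> M) : R :=
  fusion_objective p + \sum_i frob (Y i) (p.2 - p.1 i).

Definition degree (i : 'I_N) : nat := #|[pred j | e i j]|.

(* The runs of the completely distributed algorithm, from an arbitrary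
   symmetric starting point. *)
Definition distributed_admm (alpha : R)
    (Z X : nat -> 'I_N -> M) (Y : nat -> 'I_N -> 'I_N -> M) : Prop :=
  [/\ forall i, symmetric_mx (Z 0%N i) /\ symmetric_mx (X 0%N i),
      forall t i j, symmetric_mx (Y t i j)
    & forall t,
      [/\ forall i, argmax F
            (fun W =>
               frob (Aadj (D i) - \sum_(j | e i j) (Y t i j - alpha *: X t j)) W
               - (degree i)%:R * alpha / 2 * frob W W)
            (Z t.+1 i),
          forall j, argmax F
            (fun W =>
               frob (\sum_(i | e j i) (Y t i j + alpha *: Z t.+1 i)) W
               - (degree j)%:R * alpha / 2 * frob W W)
            (X t.+1 j)
        & forall i j, e i j || e j i ->
            Y t.+1 i j = Y t i j - alpha *: (X t.+1 j - Z t.+1 i)]].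

(* The runs of the semi-distributed algorithm, from an arbitrary symmetric
   starting point.  The quadratic term of the Z0 update is alpha / 2, not
   N * alpha / 2 as the augmented Lagrangian would give. *)
Definition fusion_admm (alpha : R)
    (Z : nat -> 'I_N -> M) (Z0 : nat -> M) (Y : nat -> 'I_N -> M) : Prop :=
  [/\ (forall i, symmetric_mx (Z 0%N i)) /\ symmetric_mx (Z0 0%N),
      forall t i, symmetric_mx (Y t i)
    & forall t,
      [/\ forall i, argmax F
            (fun W => frob (Aadj (D i) - Y t i + alpha *: Z0 t) W
                      - alpha / 2 * frob W W)
            (Z t.+1 i),
          argmax F
            (fun W => frob (\sum_i (Y t i + alpha *: Z t.+1 i)) W
                      - alpha / 2 * frob W W)
            (Z0 t.+1)
        & forall i, Y t.+1 i = Y t i - alpha *: (Z0 t.+1 - Z t.+1 i)]].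

End Consensus.

(* Main.v *)
Require Import Defs.
From HB Require Import structures.
From mathcomp Require Import all_boot all_order all_algebra.
From mathcomp Require Import all_classical all_reals all_analysis.
From mathcomp Require Import mxtens ring lra.
Import Order.TTheory GRing.Theory Num.Theory.
Import numFieldNormedType.Exports.
Local Open Scope classical_set_scope.
Local Open Scope ring_scope.

(** The symmetric matrix [B = Aadj (sum_i D i)] has a simple largest eigenvalue;
    let [Zs = v v^T] with [v] a unit top eigenvector.  The spectral theorem and
    the spectral gap give quadratic growth on the free spectrahedron,
    [c |Z - Zs|^2 <= <B, Zs - Z>].

    Since the graph is connected and has loops, edge multipliers [Y i j] can be
    given arbitrary row sums and column sums with equal totals.  They are chosen
    so that every block of the Lagrangian is a positive multiple of [B].  This is
    a saddle point at which every block inherits the quadratic growth.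

    Adding the variational inequalities of the block updates at [Zs] then shows
    that [|Y - Ys|^2 / alpha + alpha |X - Zs|^2], summed over the edges, decreases
    at each step by at least a multiple of the squared distance of the iterates
    to [Zs]: the cross terms form a complete square, so successive iterates need
    not be compared.  In the semi-distributed algorithm the penalty of the fusion
    variable is alpha / 2 instead of N alpha / 2; the resulting error is at most
    [(N - 1) alpha |Z0 - Zs|^2], which the growth absorbs for small alpha. *)

Set Implicit Arguments.
Unset Strict Implicit.
Unset Printing Implicit Defensive.

(** * Tensor products of matrices and the symmetry of [Aadj Y] *)

Section Tensors.
Variable R : realType.

Local Notation castsq e A := (castmx (e, e) A).

Lemma castsq_mul p q (eq_pq : p = q) (A B : 'M[R]_p) :
  castsq eq_pq (A *m B) = castsq eq_pq A *m castsq eq_pq B.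
Proof. by case: q / eq_pq; rewrite !castmx_id. Qed.

Lemma castsqN p q (eq_pq : p = q) (A : 'M[R]_p) :
  castsq eq_pq (- A) = - castsq eq_pq A.
Proof. by case: q / eq_pq; rewrite !castmx_id. Qed.

Lemma tensmx_castr a p q (eq_pq : p = q) (A : 'M[R]_a) (B : 'M[R]_p) :
  A *t castsq eq_pq B = castsq (congr1 (muln a) eq_pq) (A *t B).
Proof. by case: q / eq_pq; rewrite !castmx_id. Qed.

Lemma tensmx_castl a p q (eq_pq : p = q) (A : 'M[R]_a) (B : 'M[R]_p) :
  castsq eq_pq B *t A = castsq (congr1 (muln^~ a) eq_pq) (B *t A).
Proof. by case: q / eq_pq; rewrite !castmx_id. Qed.

Lemma tensmxA a b c (A : 'M[R]_a) (B : 'M[R]_b) (C : 'M[R]_c) :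
  castsq (mulnA a b c) (A *t (B *t C)) = A *t B *t C.
Proof.
apply/matrixP => i j; rewrite castmxE !mxE mulrA.
(* Both sides pick the same entries of [A], [B] and [C]; this is the arithmetic of iterated
   quotients and remainders. *)
congr (A _ _ * B _ _ * C _ _); apply: val_inj => /=.
1,2: by rewrite -divnMA; congr (_ %/ _)%N; rewrite mulnC.
1,2: by rewrite modn_divl.
all: by rewrite modn_dvdm // dvdn_mull.
Qed.

Lemma tensmxN a b (A : 'M[R]_a) (B : 'M[R]_b) : A *t (- B) = - (A *t B).
Proof. by apply/matrixP => i j; rewrite !mxE mulrN. Qed.

Lemma tensNmx a b (A : 'M[R]_a) (B : 'M[R]_b) : (- A) *t B = - (A *t B).
Proof. by apply/matrixP => i j; rewrite !mxE mulNr. Qed.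

(** [A ^t 1] is [A] itself and not a product with [A ^t 0], hence the separate base case and the
    cast. *)
Lemma ntensmx_recS n (A : 'M[R]_2) :
  A ^t n.+1 = castsq (esym (expnS 2 n)) (A *t A ^t n).
Proof.
case: n => [|n].
  rewrite ntensmx1 ntensmx0 [X in _ *t X](_ : _ = 1%:M) // tens_mx_scalar scale1r.
  by rewrite castmx_comp; apply/matrixP => i j; rewrite castmxE;
    congr (A _ _); apply: val_inj.
rewrite ntensmxSS; apply/matrixP => i j; rewrite castmxE.
by congr ((_ *t _) _ _); apply: val_inj.
Qed.

Lemma tensmx1 a b : (1%:M : 'M[R]_a) *t (1%:M : 'M[R]_b) = 1%:M.
Proof.
apply/matrixP => i j; case: (mxtens_indexP i) => i1 i2.
case: (mxtens_indexP j) => j1 j2; rewrite tensmxE !mxE -natrM mulnb.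
rewrite (can_eq (@mxtens_indexK a b)).
by [].
Qed.

Lemma ntensmx1_id n : (1%:M : 'M[R]_2) ^t n = 1%:M.
Proof.
elim: n => [//|n IH]; rewrite ntensmx_recS IH tensmx1.
by apply/matrixP => i j; rewrite castmxE !mxE -!val_eqE.
Qed.

(** Frees the exponent from the subtraction [n - i.+1] and from one particular proof of the
    dimension equation. *)
Lemma tens_atE n (i : 'I_n) k (dim_k : (2 ^ i * (2 * 2 ^ k) = 2 ^ n)%N)
    (A B C : 'M[R]_2) :
  (n - i.+1)%N = k -> tens_at A B C i = castsq dim_k (A ^t i *t (B *t C ^t k)).
Proof. by move=> ki; case: k / ki in dim_k *; exact: eq_castmx. Qed.

Lemma tens_at0 n (A B C : 'M[R]_2) :
  tens_at A B C (ord0 : 'I_n.+1) = castsq (esym (expnS 2 n)) (B *t C ^t n).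
Proof.
have dim_n : (2 ^ (ord0 : 'I_n.+1) * (2 * 2 ^ n) = 2 ^ n.+1)%N.
  by rewrite mul1n -expnS.
rewrite (tens_atE dim_n) ?subSS ?subn0 // ntensmx0.
rewrite (tens_scalar1mx (B *t C ^t n)) castmx_comp; exact: eq_castmx.
Qed.

(** With [tens_at0], this peels off the leading tensor factor and allows induction on [n]. *)
Lemma tens_atS n (A B C : 'M[R]_2) (i : 'I_n) :
  tens_at A B C (lift ord0 i)
  = castsq (esym (expnS 2 n)) (A *t tens_at A B C i).
Proof.
have dim_i : (2 ^ (lift ord0 i) * (2 * 2 ^ (n - i.+1)) = 2 ^ n.+1)%N.
  by rewrite -(tens_at_dim (lift ord0 i)) lift0 subSS.
rewrite (tens_atE dim_i) // /tens_at tensmx_castr castmx_comp.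
have -> : A ^t (lift ord0 i) = A ^t i.+1 by [].
rewrite (ntensmx_recS i A) tensmx_castl castmx_comp -tensmxA castmx_comp.
exact: eq_castmx.
Qed.

Lemma trmx_ntensmx n (A : 'M[R]_2) : (A ^t n)^T = A^T ^t n.
Proof.
elim: n => [|n IH]; first exact: trmx1.
by rewrite !ntensmx_recS trmx_cast trmx_tens IH.
Qed.

Lemma trmx_tens_at n (A B C : 'M[R]_2) (i : 'I_n) :
  (tens_at A B C i)^T = tens_at A^T B^T C^T i.
Proof. by rewrite /tens_at trmx_cast !trmx_tens !trmx_ntensmx. Qed.

Lemma tens_atN n (A B C : 'M[R]_2) (i : 'I_n) :
  tens_at A (- B) C i = - tens_at A B C i.
Proof. by rewrite /tens_at tensNmx tensmxN castsqN. Qed.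

Lemma tr_J2 : (J2 R)^T = - J2 R.
Proof. by apply/matrixP => i j; rewrite !mxE opprB ![(j == _) && _]andbC. Qed.

Lemma tr_sigma2 : (sigma2 R)^T = sigma2 R.
Proof. by apply/matrixP => i j; rewrite !mxE ![(j == _) && _]andbC. Qed.

Lemma sigma2_J2 : sigma2 R *m J2 R = - (J2 R *m sigma2 R).
Proof.
rewrite /sigma2 /J2 !mulmxBl !mulmxBr !mul_delta_mx_cond /=.
by rewrite !mulr0n !mulr1n !subr0 !sub0r opprK opprD addrC.
Qed.

Lemma lambda_mx0 n :
  lambda_mx R (ord0 : 'I_n.+1) = castsq (esym (expnS 2 n)) (J2 R *t 1%:M).
Proof. by rewrite /lambda_mx tens_at0 ntensmx1_id. Qed.

Lemma lambda_mxS n (i : 'I_n) :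
  lambda_mx R (lift ord0 i)
  = castsq (esym (expnS 2 n)) (sigma2 R *t lambda_mx R i).
Proof. exact: tens_atS. Qed.

Lemma rho_mx0 n :
  rho_mx R (ord0 : 'I_n.+1)
  = castsq (esym (expnS 2 n)) (J2 R *t sigma2 R ^t n).
Proof. exact: tens_at0. Qed.

Lemma rho_mxS n (i : 'I_n) :
  rho_mx R (lift ord0 i) = castsq (esym (expnS 2 n)) (1%:M *t rho_mx R i).
Proof. exact: tens_atS. Qed.

Lemma tr_lambda_mx n (i : 'I_n) : (lambda_mx R i)^T = - lambda_mx R i.
Proof. by rewrite trmx_tens_at tr_sigma2 tr_J2 trmx1 tens_atN. Qed.

Lemma tr_rho_mx n (i : 'I_n) : (rho_mx R i)^T = - rho_mx R i.
Proof. by rewrite trmx_tens_at tr_sigma2 tr_J2 trmx1 tens_atN. Qed.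

(** Among the factors of [lambda_mx R i] only [J2] fails to commute with [sigma2]; it anticommutes,
    which yields a single sign. *)
Lemma lambda_mx_sigma n (i : 'I_n) :
  lambda_mx R i *m sigma2 R ^t n = - (sigma2 R ^t n *m lambda_mx R i).
Proof.
elim: n i => [[]//|n IH i].
rewrite ntensmx_recS; case: (unliftP ord0 i) => [j|] ->.
  rewrite lambda_mxS -!castsq_mul -castsqN !tensmx_mul; congr castmx.
  by rewrite IH tensmxN.
rewrite lambda_mx0 -!castsq_mul -castsqN !tensmx_mul; congr castmx.
by rewrite mul1mx mulmx1 sigma2_J2 tensNmx opprK.
Qed.

(** If [i <= j], the factors commute position by position. If [j < i], they anticommute exactly at
    positions [i] and [j], and the two signs cancel. *)
Lemma lambda_rho_comm n (i j : 'I_n) :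
  lambda_mx R i *m rho_mx R j = rho_mx R j *m lambda_mx R i.
Proof.
elim: n i j => [[]//|n IH i j].
case: (unliftP ord0 i) => [i'|] ->; case: (unliftP ord0 j) => [j'|] ->;
  rewrite ?lambda_mx0 ?lambda_mxS ?rho_mx0 ?rho_mxS -!castsq_mul !tensmx_mul;
  congr castmx; rewrite ?mul1mx ?mulmx1 //.
- by rewrite IH.
- by rewrite lambda_mx_sigma sigma2_J2 tensmxN tensNmx opprK.
Qed.

(** Transposition reverses the product of two skew matrices; the signs cancel and commutation
    restores the order. *)
Lemma Amx_sym m (i j : 'I_m.+1) : (Amx R i j)^T = Amx R i j.
Proof.
rewrite /Amx linearN /= !trmx_mul trmxK tr_lambda_mx tr_rho_mx.
rewrite !(mulNmx, mulmxN) opprK !mulmxA.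
by rewrite -[_ *m lambda_mx R i *m _]mulmxA lambda_rho_comm mulmxA.
Qed.

Lemma Aadj_sym m (Y : 'M[R]_m.+1) : (Aadj Y)^T = Aadj Y.
Proof.
rewrite /Aadj linear_sum; apply: eq_bigr => i _; rewrite linear_sum.
by apply: eq_bigr => j _; rewrite linearZ /= Amx_sym.
Qed.

End Tensors.

(** * The spectral theorem for real symmetric matrices *)

Lemma continuous_sumr (R : realType) (T : topologicalType) (I : Type)
    (r : seq I) (P : pred I) (F : I -> T -> R) :
  (forall i, P i -> continuous (F i)) ->
  continuous (fun x => \sum_(i <- r | P i) F i x).
Proof. by apply: continuous_big; exact: add_continuous. Qed.

(** For small positive [t] the linear term wins unless [s = 0]. The test value is [s / (c + 1)],
    whose denominator is positive even for [c = 0]. *)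
Lemma linear_le_quadratic_eq0 (R : realType) (c s : R) : 0 <= c -> 0 <= s ->
  (forall t, 2 * t * s <= t ^+ 2 * c) -> s = 0.
Proof.
move=> c0 s0 ineq; apply/eqP; rewrite eq_le s0 andbT leNgt; apply/negP => s_gt0.
have c1 : 0 < c + 1 by lra.
have := ineq (s / (c + 1)); have : 0 < s / (c + 1) by rewrite divr_gt0.
have -> : s = s / (c + 1) * (c + 1) by rewrite divfK// gt_eqF.
by rewrite mulfK ?gt_eqF//; move: (s / _) => t; nra.
Qed.

Section Spectral.
Variables (R : realType) (d : nat).
Implicit Types (x y u w : 'rV[R]_d) (B : 'M[R]_d).

Lemma continuous_quad_form B : continuous (fun x => (x *m B *m x^T) 0 0).
Proof.
rewrite (_ : (fun x => _)
    = fun x => \sum_i (\sum_j x 0 j * B j i) * x 0 i); last first.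
  by apply/funext => x; rewrite mxE; apply: eq_bigr => i _; rewrite !mxE.
apply: continuous_sumr => i _ x; apply: continuousM; last exact: coord_continuous.
apply: continuous_sumr => j _ y.
by apply: continuousM; [exact: coord_continuous|exact: cst_continuous].
Qed.

Lemma sqnorm_rV x : (x *m x^T) 0 0 = \sum_i x 0 i ^+ 2.
Proof. by rewrite !mxE; apply: eq_bigr => i _; rewrite !mxE expr2. Qed.

Lemma sqnorm_rV_eq0 x : (x *m x^T) 0 0 = 0 -> x = 0.
Proof.
rewrite sqnorm_rV => /eqP; rewrite psumr_eq0; last by move=> i _; exact: sqr_ge0.
move=> /allP x0; apply/rowP => i; rewrite mxE.
by have := x0 i; rewrite mem_index_enum sqrf_eq0 => /(_ isT)/eqP.
Qed.

Let addE (A A' : 'M[R]_1) : (A + A') 0 0 = A 0 0 + A' 0 0.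
Proof. by rewrite mxE. Qed.

Let scaleE a (A : 'M[R]_1) : (a *: A) 0 0 = a * A 0 0.
Proof. by rewrite mxE. Qed.

(* A maximizer of the Rayleigh quotient on the orthogonal complement of the
   eigenvectors already found is a further eigenvector. *)
Lemma orthonormal_eigenfamily_extend k (V : 'M[R]_(k, d)) (l : 'rV[R]_k) B :
  B^T = B -> V *m V^T = 1%:M -> V *m B = diag_mx l *m V -> (k < d)%N ->
  exists w b, [/\ w *m w^T = 1%:M, w *m V^T = 0 & w *m B = b *: w].
Proof.
move=> Bsym VV VB kd.
pose S := [set x : 'rV[R]_d | (x *m x^T) 0 0 = 1 /\ x *m V^T = 0].
have S0 : S !=set0.
  (* The rank of [V^T] is at most [k < d], so some nonzero vector is orthogonal to all rows of [V];
     it is then normalized. *)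
  have /rowV0Pn[x /sub_kermxP xV x0] : kermx V^T != 0.
    by rewrite -mxrank_eq0 mxrank_ker subn_eq0 -ltnNge (leq_ltn_trans (rank_leq_col _)).
  have q0 : 0 < (x *m x^T) 0 0.
    rewrite lt_neqAle eq_sym; apply/andP; split.
      by apply/eqP => /sqnorm_rV_eq0/eqP; exact/negP.
    by rewrite sqnorm_rV sumr_ge0// => i _; exact: sqr_ge0.
  exists ((Num.sqrt ((x *m x^T) 0 0))^-1 *: x); split => /=.
    rewrite linearZ /= -scalemxAl -scalemxAr scalerA mxE -expr2 exprVn.
    by rewrite sqr_sqrtr ?ltW// mulVf// gt_eqF.
  by rewrite -scalemxAl xV scaler0.
have cS : compact S.
  apply: bounded_closed_compact.
  - exists 1; split; first exact: num_real.
    move=> M M1 x [x1 _]; rewrite /Num.Def.normr/= mx_normrE.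
    apply: bigmax_le => [|[i j] _]; first exact/ltW/(le_lt_trans _ M1).
    apply: le_trans (ltW M1).
    rewrite (ord1 i) -(@expr_le1 _ 2)// real_normK ?num_real//.
    rewrite -x1 sqnorm_rV (bigD1 j)//= lerDl sumr_ge0// => ? _; exact: sqr_ge0.
  - have -> : S = (fun x => (x *m 1%:M *m x^T) 0 0) @^-1` [set 1]
        `&` \bigcap_j [set x : 'rV[R]_d | (\sum_i x 0 i * V j i) = 0].
      apply/seteqP; split => x /=; rewrite mulmx1 => -[x1 xV]; split => //.
        move=> j _ /=; transitivity ((x *m V^T) 0 j); last by rewrite xV mxE.
        by rewrite mxE; apply: eq_bigr => i _; rewrite mxE.
      apply/rowP => j; rewrite !mxE -[RHS](xV j)//.
      by apply: eq_bigr => i _; rewrite mxE.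
    apply: closedI.
      apply: preimage_closed; last exact: closed_eq.
      by move=> y _; exact: continuous_quad_form.
    apply: closed_bigI => j _.
    apply: (@preimage_closed _ _ (fun x : 'rV[R]_d => \sum_i x 0 i * V j i)
      [set 0]).
      move=> y _; apply: continuous_sumr => i _ x.
      by apply: continuousM; [exact: coord_continuous|exact: cst_continuous].
    exact: closed_eq.
have [w /[!inE] -[/= ww wV] wmax] := EVT_max_rV S0 cS
  (continuous_subspaceT (@continuous_quad_form B)).
pose q x y : R := (x *m B *m y^T) 0 0; pose p x y : R := (x *m y^T) 0 0.
exists w, (q w w); split=> //.
  by rewrite [LHS]mx11_scalar ww.
(* The residual of the eigenvalue equation. It is orthogonal to the rows of [V], because their span
   is invariant under the symmetric [B]; hence [w] may be perturbed along [u]. *)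
have [u uE] : exists u, u = w *m B - q w w *: w by eexists.
have uV : u *m V^T = 0.
  rewrite uE mulmxBl -scalemxAl wV scaler0 subr0 -mulmxA -{1}Bsym -trmx_mul VB.
  by rewrite trmx_mul mulmxA wV mul0mx.
have pE : p u u = q w u - q w w * p w u.
  by rewrite /p {1}uE mulmxBl -scalemxAl [LHS]mxE [X in _ + X]mxE [X in - X]mxE.
have quC : q u w = q w u.
  have uw : (u *m B *m w^T)^T = w *m B *m u^T.
    by rewrite !trmx_mul trmxK Bsym mulmxA.
  by rewrite /q -uw [RHS]mxE.
have puC : p u w = p w u.
  have uw : (u *m w^T)^T = w *m u^T by rewrite trmx_mul trmxK.
  by rewrite /p -uw [RHS]mxE.
have qmax y : y *m V^T = 0 -> q y y <= q w w * p y y.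
  move=> yV; have [/sqnorm_rV_eq0 ->|y0] := eqVneq (p y y) 0.
    by rewrite /q /p !mul0mx !mxE mulr0.
  have py0 : 0 < p y y.
    by rewrite lt_neqAle eq_sym y0 /p sqnorm_rV sumr_ge0// => i _; exact: sqr_ge0.
  have sy : (Num.sqrt (p y y))^-1 *: y \in S.
    rewrite inE; split => /=; last by rewrite -scalemxAl yV scaler0.
    rewrite linearZ /= -scalemxAl -scalemxAr scalerA mxE -expr2 exprVn.
    by rewrite sqr_sqrtr ?ltW// mulVf.
  have := wmax _ sy; rewrite linearZ /= -!scalemxAl -scalemxAr scalerA mxE.
  by rewrite -expr2 exprVn sqr_sqrtr ?(ltW py0)// mulrC ler_pdivrMr.
apply/eqP; rewrite -subr_eq0; apply/eqP/sqnorm_rV_eq0; rewrite -uE -/(p u u).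
have c0 := qmax _ uV.
have s0 : 0 <= p u u by rewrite /p sqnorm_rV sumr_ge0// => i _; exact: sqr_ge0.
(* Maximality of [w] is tested at [w + t *: u]. By [pE], the terms linear in [t] differ by exactly
   [2 * t * p u u]. *)
have ineq t : 2 * t * p u u <= t ^+ 2 * (q w w * p u u - q u u).
  have := qmax (w + t *: u); rewrite mulmxDl -scalemxAl wV uV scaler0 addr0.
  have -> : q (w + t *: u) (w + t *: u) = q w w + 2 * t * q w u + t ^+ 2 * q u u.
    rewrite /q [(_ + _)^T]linearD /= [(_ *: _)^T]linearZ /=.
    rewrite !(mulmxDl, mulmxDr) -!scalemxAl -!scalemxAr.
    by rewrite !(addE, scaleE) -![(_ *m B *m _) 0 0]/(q _ _) quC; ring.
  have -> : p (w + t *: u) (w + t *: u) = 1 + 2 * t * p w u + t ^+ 2 * p u u.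
    rewrite /p [(_ + _)^T]linearD /= [(_ *: _)^T]linearZ /=.
    rewrite !(mulmxDl, mulmxDr) -!scalemxAl -!scalemxAr.
    rewrite !(addE, scaleE) ww -![(_ *m _^T) 0 0]/(p _ _).
    by rewrite puC; ring.
  by rewrite pE => /(_ erefl); lra.
apply: (@linear_le_quadratic_eq0 _ (q w w * p u u - q u u)); rewrite ?subr_ge0//.
Qed.

Lemma orthonormal_eigenfamily k B : B^T = B -> (k <= d)%N ->
  exists (V : 'M[R]_(k, d)) (l : 'rV[R]_k),
    V *m V^T = 1%:M /\ V *m B = diag_mx l *m V.
Proof.
move=> Bsym; elim: k => [_|k IH kd].
  by exists 0, 0; split; apply/matrixP => -[].
have [V [l [VV VB] ] ] := IH (ltnW kd).
have [w [b [ww wV wB] ] ] := orthonormal_eigenfamily_extend Bsym VV VB kd.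
have Vw : V *m w^T = 0 by rewrite -[LHS]trmxK trmx_mul trmxK wV trmx0.
suff : exists (V' : 'M[R]_(1 + k, d)) (l' : 'rV[R]_(1 + k)),
  V' *m V'^T = 1%:M /\ V' *m B = diag_mx l' *m V' by [].
exists (col_mx w V), (row_mx b%:M l); split.
  by rewrite tr_col_mx mul_col_row ww wV Vw VV -scalar_mx_block.
rewrite mul_col_mx wB VB diag_mx_row mul_block_col.
rewrite !mul0mx addr0 add0r; congr col_mx.
by rewrite [diag_mx _](_ : _ = b%:M) ?mul_scalar_mx//; apply/matrixP => i j;
  rewrite !ord1 !mxE.
Qed.

Lemma real_spectral B : B^T = B ->
  exists (V : 'M[R]_d) (l : 'rV[R]_d),
    V *m V^T = 1%:M /\ V *m B = diag_mx l *m V.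
Proof. by move=> /orthonormal_eigenfamily; apply. Qed.

End Spectral.

(** * The Frobenius inner product *)

Section Frobenius.
Variable R : realType.

Lemma frobE p q (A B : 'M[R]_(p, q)) : frob A B = \sum_i \sum_j A i j * B i j.
Proof.
rewrite /frob /mxtrace exchange_big; apply: eq_bigr => j _.
by rewrite mxE; apply: eq_bigr => i _; rewrite mxE.
Qed.

Lemma frobC p q (A B : 'M[R]_(p, q)) : frob A B = frob B A.
Proof.
by rewrite !frobE; apply: eq_bigr => i _; apply: eq_bigr => j _; rewrite mulrC.
Qed.

Lemma frobDr p q (A B C : 'M[R]_(p, q)) : frob A (B + C) = frob A B + frob A C.
Proof. by rewrite /frob mulmxDr mxtraceD. Qed.

Lemma frobZr p q a (A B : 'M[R]_(p, q)) : frob A (a *: B) = a * frob A B.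
Proof. by rewrite /frob -scalemxAr mxtraceZ. Qed.

Lemma frobNr p q (A B : 'M[R]_(p, q)) : frob A (- B) = - frob A B.
Proof. by rewrite -scaleN1r frobZr mulN1r. Qed.

Lemma frobBr p q (A B C : 'M[R]_(p, q)) : frob A (B - C) = frob A B - frob A C.
Proof. by rewrite frobDr frobNr. Qed.

Lemma frobDl p q (A B C : 'M[R]_(p, q)) : frob (A + B) C = frob A C + frob B C.
Proof. by rewrite ![frob _ C]frobC frobDr. Qed.

Lemma frobZl p q a (A B : 'M[R]_(p, q)) : frob (a *: A) B = a * frob A B.
Proof. by rewrite ![frob _ B]frobC frobZr. Qed.

Lemma frobNl p q (A B : 'M[R]_(p, q)) : frob (- A) B = - frob A B.
Proof. by rewrite ![frob _ B]frobC frobNr. Qed.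

Lemma frobBl p q (A B C : 'M[R]_(p, q)) : frob (A - B) C = frob A C - frob B C.
Proof. by rewrite ![frob _ C]frobC frobBr. Qed.

Lemma frob0r p q (A : 'M[R]_(p, q)) : frob A 0 = 0.
Proof. by rewrite /frob mulmx0 mxtrace0. Qed.

Lemma frob0l p q (A : 'M[R]_(p, q)) : frob 0 A = 0.
Proof. by rewrite frobC frob0r. Qed.

Lemma frob_suml p q I (r : seq I) (P : pred I) (F : I -> 'M[R]_(p, q)) A :
  frob (\sum_(i <- r | P i) F i) A = \sum_(i <- r | P i) frob (F i) A.
Proof.
by apply: (big_morph (fun X => frob X A)) => [X Y|]; rewrite ?frobDl ?frob0l.
Qed.

Lemma frob_sumr p q I (r : seq I) (P : pred I) (F : I -> 'M[R]_(p, q)) A :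
  frob A (\sum_(i <- r | P i) F i) = \sum_(i <- r | P i) frob A (F i).
Proof. by rewrite frobC frob_suml; apply: eq_bigr => i _; rewrite frobC. Qed.

Lemma frob_ge0 p q (A : 'M[R]_(p, q)) : 0 <= frob A A.
Proof.
by rewrite frobE; apply: sumr_ge0 => i _; apply: sumr_ge0 => j _;
  rewrite -expr2 sqr_ge0.
Qed.

Lemma sqr_entry_le_frob p q (A : 'M[R]_(p, q)) i j : A i j ^+ 2 <= frob A A.
Proof.
have sq_ge0 k l : 0 <= A k l * A k l by rewrite -expr2 sqr_ge0.
rewrite frobE (bigD1 i)//= (bigD1 j)//= expr2 -addrA lerDl addr_ge0//.
  by apply: sumr_ge0.
by apply: sumr_ge0 => k _; apply: sumr_ge0.
Qed.

Lemma frob_eq0 p q (A : 'M[R]_(p, q)) : frob A A = 0 -> A = 0.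
Proof.
move=> A0; apply/matrixP => i j; rewrite mxE; apply/eqP.
by rewrite -sqrf_eq0 eq_le sqr_ge0 andbT -A0 sqr_entry_le_frob.
Qed.

Lemma frob_conj d (V A B : 'M[R]_d) : V *m V^T = 1%:M ->
  frob (V *m A *m V^T) (V *m B *m V^T) = frob A B.
Proof.
move=> /mulmx1C VV; rewrite /frob !trmx_mul trmxK !mulmxA.
rewrite -[_ *m V^T *m V]mulmxA VV mulmx1 mxtrace_mulC !mulmxA VV mul1mx.
by [].
Qed.

End Frobenius.

(** * Quadratic growth on the free spectrahedron *)

Section Growth.
Variable R : realType.

(** The two-by-two principal minors are nonnegative: the form is tested on combinations of the basis
    vectors [i] and [j]. *)
Lemma psd_entry_sqr_le d (Z : 'M[R]_d) i j :
  Z^T = Z -> (forall x : 'cV[R]_d, 0 <= (x^T *m Z *m x) 0 0) ->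
  Z i j ^+ 2 <= Z i i * Z j j.
Proof.
move=> Zsym Zpsd.
have ZC : Z j i = Z i j by rewrite -{1}Zsym mxE.
have quad a b : 0 <= a ^+ 2 * Z i i + 2 * a * b * Z i j + b ^+ 2 * Z j j.
  have := Zpsd (a *: delta_mx i 0 + b *: delta_mx j 0).
  rewrite [(_ + _)^T]linearD /= ![(_ *: _)^T]linearZ /= !trmx_delta.
  rewrite !(mulmxDl, mulmxDr) -!scalemxAl -!scalemxAr.
  rewrite -!rowE -!colE !mxE ZC => q0. apply: le_trans q0 _; rewrite le_eqVlt.
  by apply/orP; left; apply/eqP; ring.
have Zii : 0 <= Z i i by have := quad 1 0; lra.
have Zjj : 0 <= Z j j by have := quad 0 1; lra.
have [Zjj0|Zjj_gt0] := eqVneq (Z j j) 0.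
  (* Here the form equals [- Z i j ^+ 2 * (Z i i + 2)], which forces [Z i j = 0]. *)
  have := quad (Z i j) (- (Z i i + 1)); rewrite Zjj0.
  by have := sqr_ge0 (Z i j); nra.
have {}Zjj_gt0 : 0 < Z j j by rewrite lt_neqAle eq_sym Zjj_gt0.
(* Here the form equals [Z j j] times the minor. *)
have := quad (Z j j) (- Z i j) => q0.
rewrite -subr_ge0 -(pmulr_rge0 _ Zjj_gt0); apply: le_trans q0 _.
by rewrite le_eqVlt; apply/orP; left; apply/eqP; ring.
Qed.

Lemma spectrahedron_frob_le1 d (Z : 'M[R]_d) :
  free_spectrahedron Z -> frob Z Z <= 1.
Proof.
move=> [Zsym Zpsd Ztr]; apply: (@le_trans _ _ (\tr Z * \tr Z)); last first.
  by rewrite Ztr mul1r.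
rewrite frobE /mxtrace mulr_suml; apply: ler_sum => i _.
rewrite mulr_sumr; apply: ler_sum => j _; rewrite -expr2.
exact: psd_entry_sqr_le.
Qed.

Lemma spectrahedron_diag_ge0 d (Z : 'M[R]_d) i :
  free_spectrahedron Z -> 0 <= Z i i.
Proof.
move=> [_ /(_ (delta_mx i 0)) Zpsd _].
by move: Zpsd; rewrite trmx_delta -rowE -colE !mxE.
Qed.

Lemma spectrahedron_conj d (V Z : 'M[R]_d) : V^T *m V = 1%:M ->
  free_spectrahedron Z -> free_spectrahedron (V *m Z *m V^T).
Proof.
move=> VV [Zsym Zpsd Ztr]; split.
- by rewrite /symmetric_mx /= !trmx_mul trmxK Zsym mulmxA.
- by move=> x; have := Zpsd (V^T *m x); rewrite trmx_mul trmxK !mulmxA.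
- by rewrite mxtrace_mulC mulmxA VV mul1mx.
Qed.

Lemma spectrahedron_delta d (k : 'I_d) :
  free_spectrahedron (delta_mx k k : 'M[R]_d).
Proof.
split.
- by rewrite /symmetric_mx /= trmx_delta.
- move=> x; rewrite -(mul_delta_mx (0 : 'I_1)) mulmxA -mulmxA -rowE -colE.
  by rewrite mxE big_ord1 !mxE -expr2 sqr_ge0.
- by rewrite /mxtrace (bigD1 k)//= big1 ?mxE ?eqxx ?addr0// => i ik;
    rewrite mxE (negPf ik).
Qed.

Lemma frob_delta d (i j : 'I_d) (Z : 'M[R]_d) : frob (delta_mx i j) Z = Z i j.
Proof.
rewrite frobE (bigD1 i)//= (bigD1 j)//= mxE !eqxx mul1r !big1 ?addr0//.
  by move=> k ki; rewrite big1// => l _; rewrite mxE (negPf ki) mul0r.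
by move=> k kj; rewrite mxE (negPf kj) andbF mul0r.
Qed.

Lemma frob_diag d (l : 'rV[R]_d) (Z : 'M[R]_d) :
  frob (diag_mx l) Z = \sum_k l 0 k * Z k k.
Proof.
rewrite frobE; apply: eq_bigr => i _; rewrite (bigD1 i)//= mxE eqxx mulr1n.
by rewrite big1 ?addr0// => j ji; rewrite mxE eq_sym (negPf ji) mul0r.
Qed.

(** Since [frob Z Z <= 1], the squared distance to the matrix unit is at most [2 * (1 - Z k0 k0)],
    while the gap makes the loss at least [g * (1 - Z k0 k0)]; hence the factor [g / 2]. *)
Lemma diag_growth d (l : 'rV[R]_d) (k0 : 'I_d) g (Z : 'M[R]_d) :
  0 <= g -> (forall k, k != k0 -> l 0 k + g <= l 0 k0) -> free_spectrahedron Z ->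
  g / 2 * frob (Z - delta_mx k0 k0) (Z - delta_mx k0 k0)
  <= frob (diag_mx l) (delta_mx k0 k0 - Z).
Proof.
move=> g0 lg FZ; rewrite !(frobBl, frobBr) (frobC Z) (frobC (diag_mx l) (delta_mx _ _)).
rewrite !frob_delta frob_diag !mxE !eqxx /= mulr1n.
have Ztr : \sum_k Z k k = 1 by case: FZ.
have sum_le : \sum_k l 0 k * Z k k <= l 0 k0 * Z k0 k0 + (l 0 k0 - g) * (1 - Z k0 k0).
  rewrite (bigD1 k0)//= lerD2l -Ztr (bigD1 k0 (F := fun k => Z k k))//=.
  rewrite [X in _ * (X - _)]addrC addrK mulr_sumr; apply: ler_sum => k kk0.
  by apply: ler_wpM2r; [exact: spectrahedron_diag_ge0|have := lg _ kk0; lra].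
have : 0 <= g * (1 - frob Z Z) by rewrite mulr_ge0 ?subr_ge0 ?spectrahedron_frob_le1.
lra.
Qed.

Lemma spectrahedron_diag_le1 d (Z : 'M[R]_d) k :
  free_spectrahedron Z -> Z k k <= 1.
Proof.
move=> FZ; have <- : \tr Z = 1 by case: FZ.
rewrite /mxtrace (bigD1 k)//= lerDl sumr_ge0// => i _.
exact: spectrahedron_diag_ge0.
Qed.

(** A second index with the top eigenvalue would put another row of [V], orthogonal to [row k0 V],
    into the line spanned by [row k0 V]. *)
Lemma spectral_gap d (B V : 'M[R]_d) (l : 'rV[R]_d) :
  V *m V^T = 1%:M -> V *m B = diag_mx l *m V -> simple_largest_eigenvalue B ->
  exists k0 g, 0 < g /\ forall k, k != k0 -> l 0 k + g <= l 0 k0.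
Proof.
move=> VV VB [a [/eigenvalueP[v vB v0] amax a1]].
have VV' := mulmx1C VV.
have row_eig k : row k V *m B = l 0 k *: row k V.
  by rewrite -row_mul VB row_mul row_diag_mx -scalemxAl -rowE.
have row_dot j k : (row j V *m (row k V)^T) 0 0 = (j == k)%:R.
  transitivity ((V *m V^T) j k); last by rewrite VV mxE.
  by rewrite !mxE; apply: eq_bigr => i _; rewrite !mxE.
have row_neq0 k : row k V != 0.
  apply/eqP => V0; have := row_dot k k; rewrite V0 mul0mx mxE eqxx => /esym/eqP.
  by rewrite oner_eq0.
have yl : v *m V^T *m diag_mx l = a *: (v *m V^T).
  have -> : diag_mx l = V *m B *m V^T by rewrite VB -mulmxA VV mulmx1.
  by rewrite !mulmxA -[v *m _ *m V]mulmxA VV' mulmx1 vB -scalemxAl.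
(* A nonzero coordinate of the top eigenvector in the basis of rows of [V]; comparing that
   coordinate in [yl] gives [l 0 k0 = a]. *)
have [k0 yk0] : exists k0, (v *m V^T) 0 k0 != 0.
  apply/rV0Pn; apply: contra_neq v0 => vV.
  by rewrite -[v]mulmx1 -VV' mulmxA vV mul0mx.
have lk0 : l 0 k0 = a.
  have /rowP/(_ k0) := yl; rewrite mul_mx_diag [LHS]mxE [RHS]mxE [RHS]mulrC.
  by move/(mulfI yk0).
(* The default 1 keeps the gap positive when [k0] is the only index. *)
exists k0, (\big[Num.min/1]_(k | k != k0) (l 0 k0 - l 0 k)); split.
  apply/bigmin_gtP; split => // k kk0; rewrite subr_gt0 lt_neqAle lk0.
  rewrite amax ?andbT; last by apply/eigenvalueP; exists (row k V).
  apply/eqP => lk.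
  have rowE_le j : l 0 j = a -> (row j V <= eigenspace B a)%MS.
    by move=> lj; apply/eigenspaceP; rewrite row_eig lj.
  have k0_le := rowE_le _ lk0.
  have le_k0 : (eigenspace B a <= row k0 V)%MS.
    by rewrite -(geq_leqif (mxrank_leqif_sup k0_le)) a1 lt0n mxrank_eq0.
  have /sub_rVP[c kc] := submx_trans (rowE_le _ lk) le_k0.
  have := row_dot k k0; rewrite kc -scalemxAl mxE row_dot eqxx mulr1 (negPf kk0).
  by move=> c0; move: (row_neq0 k); rewrite kc c0 scale0r eqxx.
by move=> k kk0; rewrite -lerBrDl; exact: bigmin_le_cond.
Qed.

(** Conjugation by [V] preserves the spectrahedron and the inner product, so the diagonal case
    suffices; [Zs] is the projector onto the top eigenline. The last clause serves the fusion
    variable, whose penalty is too small. *)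
Lemma spectrahedron_growth d (B : 'M[R]_d) :
  B^T = B -> simple_largest_eigenvalue B ->
  exists Zs c, [/\ free_spectrahedron Zs, 0 < c,
    forall Z, free_spectrahedron Z ->
      c * frob (Z - Zs) (Z - Zs) <= frob B (Zs - Z)
    & forall Z, free_spectrahedron Z -> 0 <= frob Zs (Zs - Z)].
Proof.
move=> /real_spectral[V [l [VV VB] ] ] Bsimple; have VV' := mulmx1C VV.
have [k0 [g [g0 lg] ] ] := spectral_gap VV VB Bsimple.
pose E : 'M[R]_d := delta_mx k0 k0; exists (V^T *m E *m V), (g / 2).
have conjK Z : V *m (V^T *m Z *m V) *m V^T = Z.
  by rewrite !mulmxA VV mul1mx -mulmxA VV mulmx1.
have VBV : V *m B *m V^T = diag_mx l by rewrite VB -mulmxA VV mulmx1.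
split=> [||Z FZ|Z FZ].
- by rewrite -{2}[V]trmxK; apply: spectrahedron_conj;
    [rewrite trmxK|exact: spectrahedron_delta].
- by rewrite divr_gt0.
- rewrite -(frob_conj _ _ VV) -(frob_conj B _ VV) !(mulmxBr, mulmxBl) conjK VBV.
  exact: diag_growth (ltW g0) lg (spectrahedron_conj VV' FZ).
- rewrite -(frob_conj _ _ VV) !(mulmxBr, mulmxBl) conjK frobBr !frob_delta.
  rewrite mxE !eqxx subr_ge0; exact: spectrahedron_diag_le1 (spectrahedron_conj VV' FZ).
Qed.

End Growth.

(** * Lyapunov descent and convergence of the iterates *)

Section Descent.
Variables (R : realType) (d : nat) (I J : finType) (E : I -> J -> bool).
Variables (alpha c : R) (Zs : 'M[R]_d) (Ys : I -> J -> 'M[R]_d).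
Hypotheses (alpha_gt0 : 0 < alpha) (c_gt0 : 0 < c).

(** The right side exceeds the left by the complete square [alpha * frob (b - g) (b - g)]. *)
Lemma edge_descent (a b f g : 'M[R]_d) :
  2 * (frob (a + alpha *: g) (b - f) + frob a f)
  + (alpha^-1 * frob a a + alpha * frob f f)
  <= alpha^-1 * frob (a + alpha *: b) (a + alpha *: b)
     + alpha * frob (f - g) (f - g).
Proof.
rewrite -subr_ge0.
have -> : alpha^-1 * frob (a + alpha *: b) (a + alpha *: b)
     + alpha * frob (f - g) (f - g)
     - (2 * (frob (a + alpha *: g) (b - f) + frob a f)
        + (alpha^-1 * frob a a + alpha * frob f f))
   = alpha * frob (b - g) (b - g).
  rewrite !(frobDl, frobDr, frobNl, frobNr, frobZl, frobZr).
  rewrite (frobC b a) (frobC g f) (frobC g b).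
  by field; rewrite gt_eqF.
by rewrite mulr_ge0 ?frob_ge0 ?ltW.
Qed.

(** The bipartite relation [E] covers both algorithms: the copies [X] are indexed by all vertices,
    the fusion variable by a single index. *)
Definition lyapunov (X : J -> 'M[R]_d) (Y : I -> J -> 'M[R]_d) : R :=
  \sum_i \sum_(j | E i j)
    (alpha^-1 * frob (Y i j - Ys i j) (Y i j - Ys i j)
     + alpha * frob (X j - Zs) (X j - Zs)).

Definition sqdist (Z : I -> 'M[R]_d) (X : J -> 'M[R]_d) : R :=
  \sum_i frob (Z i - Zs) (Z i - Zs) + \sum_j frob (X j - Zs) (X j - Zs).

Lemma lyapunov_ge0 X Y : 0 <= lyapunov X Y.
Proof.
apply: sumr_ge0 => i _; apply: sumr_ge0 => j _.
by rewrite addr_ge0// mulr_ge0 ?frob_ge0// ?invr_ge0 ltW.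
Qed.

Lemma sqdist_ge0 Z X : 0 <= sqdist Z X.
Proof. by rewrite addr_ge0//; apply: sumr_ge0 => i _; exact: frob_ge0. Qed.

(** The block inequalities, summed and regrouped by edges, leave one instance of [edge_descent] per
    edge, in which [b - g] is [X j - Z' i]. *)
Lemma lyapunov_descent (Z' : I -> 'M[R]_d) (X X' : J -> 'M[R]_d)
    (Y Y' : I -> J -> 'M[R]_d) :
  (forall i, c * frob (Z' i - Zs) (Z' i - Zs) <=
     \sum_(j | E i j) frob (Y' i j - Ys i j + alpha *: (X' j - X j)) (Zs - Z' i)) ->
  (forall j, c * frob (X' j - Zs) (X' j - Zs) <=
     \sum_(i | E i j) frob (Y' i j - Ys i j) (X' j - Zs)) ->
  (forall i j, E i j -> Y' i j = Y i j - alpha *: (X' j - Z' i)) ->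
  2 * c * sqdist Z' X' + lyapunov X' Y' <= lyapunov X Y.
Proof.
move=> hZ hX hY.
pose s i j := frob (Y' i j - Ys i j + alpha *: (X' j - X j)) (Zs - Z' i)
  + frob (Y' i j - Ys i j) (X' j - Zs).
have sqdist_le : c * sqdist Z' X' <= \sum_i \sum_(j | E i j) s i j.
  rewrite mulrDr !mulr_sumr; under [leRHS]eq_bigr do rewrite big_split.
  rewrite big_split /=; apply: lerD; first exact: ler_sum.
  by rewrite (exchange_big_dep xpredT)//=; exact: ler_sum.
rewrite -mulrA; apply: (@le_trans _ _
  (2 * \sum_i \sum_(j | E i j) s i j + lyapunov X' Y')).
  by rewrite lerD2r ler_pM2l.
rewrite mulr_sumr -big_split /=; apply: ler_sum => i _.
rewrite mulr_sumr -big_split /=; apply: ler_sum => j /hY Yij.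
have := edge_descent (Y' i j - Ys i j) (X' j - Z' i) (X' j - Zs) (X' j - X j).
have -> : X' j - Z' i - (X' j - Zs) = Zs - Z' i.
  by apply/matrixP => k l; rewrite !mxE; ring.
have -> : X' j - Zs - (X' j - X j) = X j - Zs.
  by apply/matrixP => k l; rewrite !mxE; ring.
have -> : Y' i j - Ys i j + alpha *: (X' j - Z' i) = Y i j - Ys i j.
  by rewrite Yij addrAC subrK.
by [].
Qed.

Lemma cvg_mx_frob (u : nat -> 'M[R]_d) (L : 'M[R]_d) (s : nat -> R) :
  (forall t, frob (u t - L) (u t - L) <= s t) -> s t @[t --> \oo] --> (0 : R) ->
  u t @[t --> \oo] --> L.
Proof.
move=> us s0; apply/cvg_ballP => e e0.
have e2 : 0 < e ^+ 2 by rewrite exprn_gt0.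
have /cvgrPdist_lt/(_ _ e2) := s0; apply: filterS => t /=; rewrite sub0r normrN => st.
split=> // i j; rewrite /ball /= -(@ltr_pXn2r _ 2) ?nnegrE ?(ltW e0)//.
rewrite real_normK ?num_real// (le_lt_trans _ st)// (le_trans _ (ler_norm _))//.
apply: le_trans (us t); apply: le_trans (sqr_entry_le_frob _ i j).
by rewrite !mxE -sqrrN opprB.
Qed.

(** The Lyapunov values decrease and are bounded below, so their decrements tend to 0; these
    dominate the squared distances at time [t.+1]. *)
Lemma lyapunov_cvg (Z : nat -> I -> 'M[R]_d) (X : nat -> J -> 'M[R]_d)
    (Y : nat -> I -> J -> 'M[R]_d) :
  (forall t, 2 * c * sqdist (Z t.+1) (X t.+1) + lyapunov (X t.+1) (Y t.+1)
     <= lyapunov (X t) (Y t)) ->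
  (forall i, Z t i @[t --> \oo] --> Zs) /\ (forall j, X t j @[t --> \oo] --> Zs).
Proof.
move=> desc; pose V t := lyapunov (X t) (Y t).
have V_cvg : cvgn V.
  apply: nonincreasing_is_cvgn.
    apply/nonincreasing_seqP => t; apply: le_trans (desc t).
    by rewrite lerDr mulr_ge0 ?sqdist_ge0// mulr_ge0 ?ltW.
  by exists 0 => _ [t _ <-]; exact: lyapunov_ge0.
have V'_cvg : V t.+1 @[t --> \oo] --> limn V by rewrite cvg_shiftS.
have dV : (V t - V t.+1) / (2 * c) @[t --> \oo] --> (0 : R).
  rewrite -[X in _ --> X](mul0r (2 * c)^-1) -(subrr (limn V)).
  by apply: cvgM; [exact: cvgB|exact: cvg_cst].
have sqdistV t : sqdist (Z t.+1) (X t.+1) <= (V t - V t.+1) / (2 * c).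
  by rewrite ler_pdivlMr ?mulr_gt0// mulrC lerBrDr desc.
have term_le (K : finType) (A : K -> 'M[R]_d) k :
    frob (A k) (A k) <= \sum_l frob (A l) (A l).
  by rewrite (bigD1 k)//= lerDl sumr_ge0// => l _; exact: frob_ge0.
have sum_ge0 (K : finType) (A : K -> 'M[R]_d) : 0 <= \sum_l frob (A l) (A l).
  by apply: sumr_ge0 => l _; exact: frob_ge0.
split=> k; rewrite -cvg_shiftS /=; apply: (cvg_mx_frob _ dV) => t;
  apply: le_trans (sqdistV t); rewrite /sqdist.
  by rewrite ler_wpDr// (term_le _ (fun i => Z t.+1 i - Zs)).
by rewrite ler_wpDl// (term_le _ (fun j => X t.+1 j - Zs)).
Qed.

End Descent.

(** * Edge multipliers with prescribed row and column sums *)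

Section Multipliers.
Variables (R : realType) (N : nat) (e : rel 'I_N).
Hypotheses (e_connected : forall i j, connect e i j) (e_loops : forall i, e i i).

Lemma sum_indicator (P : pred 'I_N) (a : 'I_N) :
  \sum_(j | P j) ((j == a)%:R : R) = (P a)%:R.
Proof.
rewrite big_mkcond (bigD1 a)//= big1 ?addr0 ?eqxx; first by case: (P a).
by move=> j ja; rewrite (negPf ja); case: (P j).
Qed.

(* Along an edge [i -> k], adding 1 at [(i, k)] and subtracting 1 at [(k, k)]
   moves row mass from [k] to [i] and leaves all column sums unchanged. *)
Lemma unit_transport (root k : 'I_N) :
  exists y : 'I_N -> 'I_N -> R,
    (forall i, \sum_(j | e i j) y i j = (i == k)%:R - (i == root)%:R) /\
    (forall j, \sum_(i | e i j) y i j = 0).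
Proof.
have /connectP[p] := e_connected k root.
elim: p k => [|k1 p IH] k /=.
  move=> _ ->; exists (fun _ _ => 0); split=> i; rewrite ?big1 ?subrr//.
move=> /andP[ekk1 /IH{}IH] /IH[y [yrow ycol] ].
exists (fun i j => y i j + ((i == k)%:R - (i == k1)%:R) * (j == k1)%:R).
split=> [i|j]; rewrite big_split /=.
  rewrite yrow -mulr_sumr sum_indicator.
  have [->|ik] := eqVneq i k.
    by rewrite ekk1 mulr1; ring.
  have [->|ik1] := eqVneq i k1; first by rewrite e_loops mulr1; ring.
  by rewrite subrr mul0r addr0.
rewrite ycol add0r -mulr_suml sumrB !sum_indicator.
have [->|jk1] := eqVneq j k1; last by rewrite mulr0.
by rewrite ekk1 e_loops subrr mul0r.
Qed.

Lemma edge_transport d (r s : 'I_N -> 'M[R]_d) :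
  (forall i, symmetric_mx (r i)) -> (forall i, symmetric_mx (s i)) ->
  \sum_i r i = \sum_i s i ->
  exists Y : 'I_N -> 'I_N -> 'M[R]_d,
    [/\ forall i j, symmetric_mx (Y i j),
        forall i, \sum_(j | e i j) Y i j = r i
      & forall j, \sum_(i | e i j) Y i j = s j].
Proof.
move=> rsym ssym rs.
have [root|/(_ _) noI] := pickP (fun _ : 'I_N => true); last first.
  by exists (fun _ _ => 0); split=> i; have := noI i.
move=> _.
have /choice[y yP] := unit_transport root.
have indZ (P : pred 'I_N) (a : 'I_N) (A : 'M[R]_d) :
    \sum_(j | P j) (j == a)%:R *: A = (P a)%:R *: A.
  by rewrite -scaler_suml sum_indicator.
(* Placing [s i] on the loop at [i] gives the right column sums. The row defects [r k - s k] are
   carried by the transports; what these deposit at [root] cancels since the defects sum to 0. *)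
exists (fun i j => (i == j)%:R *: s i + \sum_k y k i j *: (r k - s k)).
split=> [i j|i|j].
- rewrite /symmetric_mx /= linearD /= linearZ /= ssym linear_sum /=.
  congr (_ + _); apply: eq_bigr => k _.
  by rewrite linearZ /= linearB /= rsym ssym.
- rewrite big_split /= exchange_big /=.
  rewrite (eq_bigr (fun j => (j == i)%:R *: s i)); last first.
    by move=> j _; rewrite eq_sym.
  rewrite indZ e_loops scale1r.
  rewrite (eq_bigr (fun k => (k == i)%:R *: (r k - s k)
      - (i == root)%:R *: (r k - s k))); last first.
    by move=> k _; rewrite -scaler_suml (yP k).1 scalerBl eq_sym.
  rewrite sumrB -scaler_sumr sumrB rs subrr scaler0 subr0.
  rewrite (eq_bigr (fun k => (k == i)%:R *: (r i - s i))); last first.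
    by move=> k _; case: eqVneq => [->//|_]; rewrite !scale0r.
  by rewrite (indZ xpredT) scale1r addrC subrK.
- rewrite big_split /= exchange_big /=.
  rewrite (eq_bigr (fun i => (i == j)%:R *: s j)); last first.
    by move=> i _; case: eqVneq => [->//|_]; rewrite !scale0r.
  rewrite indZ e_loops scale1r big1 ?addr0// => k _.
  by rewrite -scaler_suml (yP k).2 scale0r.
Qed.

End Multipliers.

(** * The first-order condition for a block update *)

Section Optimality.
Variable R : realType.

Lemma spectrahedron_convex d (A B : 'M[R]_d) (t : R) : 0 <= t -> t <= 1 ->
  free_spectrahedron A -> free_spectrahedron B ->
  free_spectrahedron (t *: A + (1 - t) *: B).
Proof.
move=> t0 t1 [Asym Apsd Atr] [Bsym Bpsd Btr]; split.
- by rewrite /symmetric_mx /= linearD /= !linearZ /= Asym Bsym.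
- move=> x; rewrite mulmxDr mulmxDl -!scalemxAr -!scalemxAl mxE.
  rewrite [X in X + _]mxE [X in _ + X]mxE.
  by rewrite addr_ge0// mulr_ge0// subr_ge0.
- by rewrite mxtraceD !mxtraceZ Atr Btr; ring.
Qed.

Lemma argmax_variational d (A Z W : 'M[R]_d) (k : R) : 0 <= k ->
  argmax (@free_spectrahedron R d) (fun V => frob A V - k / 2 * frob V V) Z ->
  free_spectrahedron W -> frob (A - k *: Z) (W - Z) <= 0.
Proof.
move=> k0 [FZ Zmax] FW; rewrite leNgt; apply/negP.
set p := frob _ _ => p0; set s := k * frob (W - Z) (W - Z).
have s0 : 0 <= s by rewrite mulr_ge0 ?frob_ge0.
have ps0 : 0 < p + s by lra.
(* A step from [Z] towards [W] with [t * s <= p], whereas maximality along the segment would demand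
   [p <= t * s / 2]. *)
pose t := p / (p + s).
have t0 : 0 < t by rewrite divr_gt0.
have t1 : t <= 1 by rewrite ler_pdivrMr// mul1r; lra.
have := Zmax _ (spectrahedron_convex (ltW t0) t1 FW FZ).
have -> : t *: W + (1 - t) *: Z = Z + t *: (W - Z).
  by apply/matrixP => i j; rewrite !mxE; ring.
have pE : p = frob A (W - Z) - k * frob Z (W - Z) by rewrite /p frobBl frobZl.
have expand V : frob (Z + t *: V) (Z + t *: V)
    = frob Z Z + 2 * t * frob Z V + t * t * frob V V.
  by rewrite !(frobDl, frobDr, frobZl, frobZr) (frobC V Z); ring.
rewrite expand frobDr frobZr => ineq.
have {}ineq : t * p <= t * (t * s) / 2 by rewrite pE /s; lra.
have tE : t * (p + s) = p by rewrite divfK// gt_eqF.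
have : p <= t * s / 2 by rewrite -(ler_pM2l t0); lra.
nra.
Qed.

End Optimality.

(** * The two algorithms as instances of the descent *)

Section Runs.
Variables (R : realType) (m N : nat) (e : rel 'I_N) (D : 'I_N -> 'M[R]_m.+1).
Variables (alpha c : R) (Zs : 'M[R]_(2 ^ m)).
Hypotheses (alpha_gt0 : 0 < alpha) (c_gt0 : 0 < c).
Hypothesis FZs : free_spectrahedron Zs.

(** After substitution of the dual update, the gradient of the [Z] block is [Aadj (D i)] minus the
    row sum of [Y' + alpha *: (X' - X)], primes marking time [t.+1], and that of the [X] block is
    the column sum of [Y']. *)
Lemma distributed_admm_cvg (Ys : 'I_N -> 'I_N -> 'M[R]_(2 ^ m))
    (Z X : nat -> 'I_N -> 'M[R]_(2 ^ m))
    (Y : nat -> 'I_N -> 'I_N -> 'M[R]_(2 ^ m)) :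
  symmetric e ->
  (forall i W, free_spectrahedron W -> c * frob (W - Zs) (W - Zs) <=
     frob (Aadj (D i) - \sum_(j | e i j) Ys i j) (Zs - W)) ->
  (forall j W, free_spectrahedron W -> c * frob (W - Zs) (W - Zs) <=
     frob (\sum_(i | e i j) Ys i j) (Zs - W)) ->
  distributed_admm e D alpha Z X Y ->
  (forall i, Z t i @[t --> \oo] --> Zs) /\ (forall j, X t j @[t --> \oo] --> Zs).
Proof.
move=> esym Zgrowth Xgrowth [_ _ run].
apply: (lyapunov_cvg (E := e) (c := c) (Ys := Ys) alpha_gt0 c_gt0) => t.
have [Zmax Xmax Yup] := run t.
have {}Yup i j : e i j -> Y t.+1 i j = Y t i j - alpha *: (X t.+1 j - Z t.+1 i).
  by move=> eij; apply: Yup; rewrite eij.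
have degE i (A : 'M[R]_(2 ^ m)) :
    ((degree e i)%:R * alpha) *: A = \sum_(j | e i j) alpha *: A.
  by rewrite sumr_const -[RHS]scaler_nat scalerA.
have deg_ge0 i : 0 <= (degree e i)%:R * alpha by rewrite mulr_ge0 ?ler0n ?ltW.
apply: (lyapunov_descent alpha_gt0 _ _ Yup) => [i|j].
- have FZ : free_spectrahedron (Z t.+1 i) by case: (Zmax i).
  rewrite -frob_suml; apply: le_trans (Zgrowth i _ FZ) _.
  rewrite -subr_ge0 -frobBl -oppr_le0 -frobNl.
  apply: le_trans (argmax_variational (deg_ge0 i) (Zmax i) FZs).
  rewrite le_eqVlt; apply/orP; left; apply/eqP; congr (frob _ _).
  rewrite degE opprB [LHS]addrAC -!addrA; congr (_ + _).
  rewrite -opprD -opprD; congr (- _); rewrite -!big_split /=.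
  apply: eq_bigr => j eij; rewrite Yup//.
  by apply/matrixP => k l; rewrite !mxE; ring.
- have FX : free_spectrahedron (X t.+1 j) by case: (Xmax j).
  have opt : frob (\sum_(i | e i j) Y t.+1 i j) (Zs - X t.+1 j) <= 0.
    apply: le_trans (argmax_variational (deg_ge0 j) (Xmax j) FZs).
    rewrite le_eqVlt; apply/orP; left; apply/eqP; congr (frob _ _).
    (* The [X] update sums over [e j i] but the Lagrangian over [e i j]; symmetry of the graph
       identifies the two. *)
    rewrite degE -sumrB (eq_bigl (fun i => e j i)); last by move=> i; exact: esym.
    apply: eq_bigr => i eji; rewrite Yup; last by rewrite esym.
    by apply/matrixP => k l; rewrite !mxE; ring.
  have -> : \sum_(i | e i j) frob (Y t.+1 i j - Ys i j) (X t.+1 j - Zs)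
      = frob (\sum_(i | e i j) Ys i j) (Zs - X t.+1 j)
        - frob (\sum_(i | e i j) Y t.+1 i j) (Zs - X t.+1 j).
    rewrite !frob_suml -sumrB; apply: eq_bigr => i _.
    by rewrite -(opprB Zs) frobNr frobBl opprB.
  have := Xgrowth j _ FX.
  lra.
Qed.

Lemma fusion_admm_cvg (Ys : 'I_N -> 'M[R]_(2 ^ m))
    (Z : nat -> 'I_N -> 'M[R]_(2 ^ m)) (Z0 : nat -> 'M[R]_(2 ^ m))
    (Y : nat -> 'I_N -> 'M[R]_(2 ^ m)) :
  (0 < N)%N -> N%:R * alpha <= c ->
  (forall W, free_spectrahedron W -> 0 <= frob Zs (Zs - W)) ->
  (forall i W, free_spectrahedron W -> c * frob (W - Zs) (W - Zs) <=
     frob (Aadj (D i) - Ys i) (Zs - W)) ->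
  (forall W, free_spectrahedron W -> 2 * c * frob (W - Zs) (W - Zs) <=
     frob (\sum_i Ys i) (Zs - W)) ->
  fusion_admm D alpha Z Z0 Y ->
  (forall i, Z t i @[t --> \oo] --> Zs) /\ (Z0 t @[t --> \oo] --> Zs).
Proof.
move=> N_gt0 Nalpha Zs_max Zgrowth Z0growth [_ _ run].
suff [Zcvg Z0cvg] : (forall i, Z t i @[t --> \oo] --> Zs) /\
    (forall j : 'I_1, Z0 t @[t --> \oo] --> Zs).
  by split=> //; exact: Z0cvg ord0.
apply: (lyapunov_cvg (E := fun _ _ => true) (c := c) (Ys := fun i _ => Ys i)
  (X := fun t _ => Z0 t) (Y := fun t i _ => Y t i) alpha_gt0 c_gt0) => t.
have [Zmax Z0max Yup] := run t.
have alpha_ge0 := ltW alpha_gt0.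
apply: (lyapunov_descent alpha_gt0 _ _ (fun i _ _ => Yup i)) => [i|_].
- have FZ : free_spectrahedron (Z t.+1 i) by case: (Zmax i).
  rewrite big_ord1; apply: le_trans (Zgrowth i _ FZ) _.
  rewrite -subr_ge0 -frobBl -oppr_le0 -frobNl.
  apply: le_trans (argmax_variational alpha_ge0 (Zmax i) FZs).
  rewrite le_eqVlt; apply/orP; left; apply/eqP; congr (frob _ _).
  by rewrite Yup; apply/matrixP => k l; rewrite !mxE; ring.
- have FZ0 : free_spectrahedron (Z0 t.+1) by case: Z0max.
  have := argmax_variational alpha_ge0 Z0max FZs.
  (* The dual updates produce [N] copies of [alpha *: Z0 t.+1], of which the penalty cancels one;
     the other [N - 1] are the error term. *)
  have -> : \sum_i (Y t i + alpha *: Z t.+1 i)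
      = \sum_i Y t.+1 i + (N%:R * alpha) *: Z0 t.+1.
    rewrite -[in N%:R](card_ord N) -scalerA scaler_nat -sumr_const -big_split /=.
    by apply: eq_bigr => i _; rewrite Yup; apply/matrixP => k l; rewrite !mxE; ring.
  rewrite -addrA -scalerBl [frob (_ + _ *: _) _]frobDl frobZl => opt.
  have := Z0growth _ FZ0; have := Zs_max _ FZ0.
  have -> : \sum_(i | true) frob (Y t.+1 i - Ys i) (Z0 t.+1 - Zs)
      = frob (\sum_i Ys i) (Zs - Z0 t.+1) - frob (\sum_i Y t.+1 i) (Zs - Z0 t.+1).
    rewrite !frob_suml -sumrB; apply: eq_bigr => i _.
    by rewrite -(opprB Zs) frobNr frobBl opprB.
  (* The first term on the right is nonnegative, so the error costs at most [(N - 1) * alpha] times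
     the squared distance; half of the growth [2 * c] pays for it. *)
  have Z0E : frob (Z0 t.+1) (Zs - Z0 t.+1)
      = frob Zs (Zs - Z0 t.+1) - frob (Z0 t.+1 - Zs) (Z0 t.+1 - Zs).
    by rewrite !(frobBl, frobBr); ring.
  have N_ge1 : (1 : R) <= N%:R by rewrite ler1n.
  have : (N%:R * alpha - alpha) * frob (Z0 t.+1 - Zs) (Z0 t.+1 - Zs)
      <= c * frob (Z0 t.+1 - Zs) (Z0 t.+1 - Zs).
    by rewrite ler_wpM2r ?frob_ge0//; lra.
  have Nalpha0 : 0 <= N%:R * alpha - alpha.
    by have := ler_wpM2r alpha_ge0 N_ge1; rewrite mul1r subr_ge0.
  move: opt; rewrite Z0E => opt h1 h2 h3.
  have := mulr_ge0 Nalpha0 h2; lra.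
Qed.

End Runs.

(** * Closed, proper and convex extended-valued objectives *)

Section RestrictedNeg.
Variable R : realType.

Lemma restricted_neg_le T (S : set T) (f : T -> R) x r :
  (restricted_neg S f x <= r%:E)%E <-> S x /\ - f x <= r.
Proof.
rewrite /restricted_neg; case: ifPn => [/[!inE]|/negP/[!inE]] Sx.
  by rewrite lee_fin; split=> [//|[]].
by split=> // -[].
Qed.

Lemma closed_restricted_neg (T : topologicalType) (S : set T) (f : T -> R) :
  closed S -> continuous f -> closed_function (restricted_neg S f).
Proof.
move=> clS cf; rewrite /closed_function.
have -> : [set p : T * R | (restricted_neg S f p.1 <= p.2%:E)%E]
    = fst @^-1` S `&` (fun p : T * R => p.2 + f p.1) @^-1` [set x | 0 <= x].
  by apply/seteqP; split=> -[x r] /=; rewrite restricted_neg_le -lerBlDr sub0r.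
apply: closedI; apply: preimage_closed; try exact: closed_ge; try exact: clS.
  by move=> p _; exact: cvg_fst.
move=> p _; apply: cvgD; first exact: cvg_snd.
by apply: (@cvg_comp _ _ _ fst f); [exact: cvg_fst|exact: cf].
Qed.

Lemma proper_restricted_neg T (S : set T) (f : T -> R) :
  S !=set0 -> proper_function (restricted_neg S f).
Proof.
move=> [x Sx]; split=> [y|]; first by rewrite /restricted_neg; case: ifP.
by exists x; rewrite /restricted_neg mem_set// ltry.
Qed.

Lemma convex_restricted_neg (V : lmodType R) (S : set V) (f : V -> R) :
  (forall x y t, 0 <= t -> t <= 1 -> S x -> S y -> S (t *: x + (1 - t) *: y)) ->
  (forall x y t, f (t *: x + (1 - t) *: y) = t * f x + (1 - t) * f y) ->
  convex_efunction (restricted_neg S f).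
Proof.
move=> Sconv flin [x r] [y s] t; rewrite !inE /=.
move=> /restricted_neg_le[Sx fx] /restricted_neg_le[Sy fy].
have t0 : 0 <= t%:num by [].
have t1 : t%:num <= 1 by [].
apply/restricted_neg_le; split; first exact: Sconv.
rewrite /= flin opprD -!mulrN lerD// ler_wpM2l// subr_ge0//.
Qed.

End RestrictedNeg.

Section ClosedProperConvex.
Variable R : realType.

Lemma continuous_frob d (A : 'M[R]_d) : continuous (frob A).
Proof.
rewrite (_ : frob A = fun Z => \sum_i \sum_j A i j * Z i j); last first.
  by apply/funext => Z; rewrite frobE.
apply: continuous_sumr => i _; apply: continuous_sumr => j _ Z.
by apply: continuousM; [exact: cst_continuous|exact: coord_continuous].
Qed.

(** Every defining condition is a closed condition on a continuous functional [frob A]: differences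
    of matrix units test symmetry, rank-one matrices [x *m x^T] positivity, the identity the
    trace. *)
Lemma closed_spectrahedron d : closed (@free_spectrahedron R d).
Proof.
have -> : @free_spectrahedron R d =
    \bigcap_(ij : 'I_d * 'I_d)
      (frob (delta_mx ij.1 ij.2 - delta_mx ij.2 ij.1) @^-1` [set 0])
    `&` (\bigcap_(x : 'cV[R]_d) (frob (x *m x^T) @^-1` [set y | 0 <= y])
    `&` frob 1%:M @^-1` [set 1]).
  have frob_rank1 (x : 'cV[R]_d) (Z : 'M[R]_d) :
      frob (x *m x^T) Z = (x^T *m Z *m x) 0 0.
    by rewrite /frob trmx_mul trmxK -[x *m _ *m Z]mulmxA mxtrace_mulC trace_mx11.
  apply/seteqP; split=> Z /=.
    move=> [Zsym Zpsd Ztr]; split=> [[i j] _|] /=.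
      by rewrite frobBl !frob_delta -{1}Zsym mxE subrr.
    by split=> [x _|] /=; rewrite ?frob_rank1// /frob trmx1 mul1mx.
  move=> [Zsym [Zpsd Ztr] ]; split=> [|x|].
  - apply/matrixP => i j; rewrite mxE; apply/eqP; rewrite -subr_eq0.
    by have /= := Zsym (j, i) I; rewrite frobBl !frob_delta => ->.
  - by have /= := Zpsd x I; rewrite frob_rank1.
  - by move: Ztr; rewrite /frob trmx1 mul1mx.
have cf (A : 'M[R]_d) (C : set R) : closed C -> closed (frob A @^-1` C).
  by move=> clC; apply: preimage_closed => // Z _; exact: continuous_frob.
apply: closedI; first by apply: closed_bigI => ij _; apply: cf; exact: closed_eq.
apply: closedI; first by apply: closed_bigI => x _; apply: cf; exact: closed_ge.
apply: cf; exact: closed_eq.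
Qed.

Variables (m N : nat).
Let M := 'M[R]_(2 ^ m).

Lemma spectrahedron_nonempty : (@free_spectrahedron R (2 ^ m)) !=set0.
Proof.
have k : 'I_(2 ^ m) by exact: (Ordinal (expn_gt0 2 m)).
by exists (delta_mx k k); exact: spectrahedron_delta.
Qed.

Lemma closed_F_family : closed (@F_family R m N : set {ptws 'I_N -> M}).
Proof.
have -> : (@F_family R m N : set {ptws 'I_N -> M})
    = \bigcap_i (proj i @^-1` @free_spectrahedron R (2 ^ m)).
  by apply/seteqP; split=> Z FZ i //=; [move=> _; exact: FZ|exact: FZ i I].
apply: closed_bigI => i _; apply: preimage_closed; last exact: closed_spectrahedron.
by move=> Z _; exact: proj_continuous.
Qed.

Lemma closed_proper_convex_restricted_neg (f : ('I_N -> M) -> R) :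
  continuous (f : {ptws 'I_N -> M} -> R) ->
  (forall x y t, f (t *: x + (1 - t) *: y) = t * f x + (1 - t) * f y) ->
  closed_proper_convex_family (restricted_neg (@F_family R m N) f).
Proof.
move=> cf flin; split.
- exact: (closed_restricted_neg closed_F_family cf).
- apply: proper_restricted_neg; have [Z FZ] := spectrahedron_nonempty.
  by exists (fun=> Z).
- apply: convex_restricted_neg => // x y t t0 t1 Fx Fy i.
  exact: spectrahedron_convex.
Qed.

Lemma closed_proper_convex_objective (D : 'I_N -> 'M[R]_m.+1) :
  closed_proper_convex_family (restricted_neg (@F_family R m N) (objective D)).
Proof.
apply: closed_proper_convex_restricted_neg.
  apply: continuous_sumr => i _ Z.
  by apply: (@cvg_comp _ _ _ (proj i)); [exact: proj_continuous|exact: continuous_frob].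
move=> x y t; rewrite /objective !mulr_sumr -big_split; apply: eq_bigr => i _ /=.
by rewrite frobDr !frobZr.
Qed.

(** The second block carries no cost of its own: its objective is zero on its domain, for the copies
    [X] here and for the fusion variable in the next lemma. *)
Lemma closed_proper_convex_F_family :
  closed_proper_convex_family (restricted_neg (@F_family R m N) (fun=> 0)).
Proof.
apply: closed_proper_convex_restricted_neg => [|x y t].
  exact: cst_continuous.
by rewrite !mulr0 addr0.
Qed.

Lemma closed_proper_convex_spectrahedron :
  closed_proper_convex_mx
    (restricted_neg (@free_spectrahedron R (2 ^ m)) (fun=> 0)).
Proof.
split.
- by apply: closed_restricted_neg; [exact: closed_spectrahedron|exact: cst_continuous].
- exact/proper_restricted_neg/spectrahedron_nonempty.
- apply: convex_restricted_neg => [x y t|x y t]; last by rewrite !mulr0 addr0.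
  exact: spectrahedron_convex.
Qed.

End ClosedProperConvex.

(** * Strong duality from a saddle point *)

Section SaddlePoints.
Variable R : realType.

(** At [x0] the coupling terms vanish, so every dual value is at least [f x0], and [y0] attains this
    bound. *)
Lemma saddle_strong_duality (T U : Type) (P S : set T) (Q : set U)
    (L : T -> U -> R) (f : T -> R) (x0 : T) (y0 : U) :
  P x0 -> S x0 -> Q y0 -> (forall y, L x0 y = f x0) ->
  (forall x, P x -> L x y0 <= f x0) -> (forall x, S x -> f x <= f x0) ->
  saddle_point P Q L x0 y0 /\ strong_duality P Q L S f.
Proof.
move=> Px0 Sx0 Qy0 Lx0 Ly0 fmax; split.
  by split=> // [x /Ly0|y _]; rewrite !Lx0.
rewrite /strong_duality; have -> : ereal_sup [set (f x)%:E | x in S] = (f x0)%:E.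
  apply/le_anti/andP; split.
    by apply: ge_ereal_sup => _ [x Sx <-]; rewrite lee_fin fmax.
  by apply: ereal_sup_ubound; exists x0.
apply/le_anti/andP; split.
  apply: (@le_trans _ _ (ereal_sup [set (L x y0)%:E | x in P])).
    by apply: ereal_inf_lbound; exists y0.
  by apply: ge_ereal_sup => _ [x Px <-]; rewrite lee_fin Ly0.
apply: le_ereal_inf_tmp => _ [y Qy <-].
by apply: ereal_sup_ubound; exists x0; rewrite ?Lx0.
Qed.

End SaddlePoints.

(** * Uniqueness, duality, convergence and the rotation property *)

Section Assembly.
Variables (R : realType) (m N : nat) (e : rel 'I_N) (D : 'I_N -> 'M[R]_m.+1).
Hypotheses (N_gt0 : (0 < N)%N) (e_connected : forall i j, connect e i j).
Hypothesis e_loops : forall i, e i i.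

Local Notation M := 'M[R]_(2 ^ m).
Local Notation F := (@free_spectrahedron R (2 ^ m)).
Local Notation B := (Aadj (\sum_i D i)).

Lemma frob_Aadj (Y : 'M[R]_m.+1) (W : M) : frob (Aadj Y) W = frob Y (Amap W).
Proof.
rewrite /Aadj frob_suml [RHS]frobE; apply: eq_bigr => i _.
by rewrite frob_suml; apply: eq_bigr => j _; rewrite frobZl mxE.
Qed.

Lemma Aadj_sum : B = \sum_i Aadj (D i).
Proof.
rewrite /Aadj [RHS]exchange_big; apply: eq_bigr => k _ /=.
rewrite [RHS]exchange_big; apply: eq_bigr => l _ /=.
by rewrite summxE scaler_suml.
Qed.

Lemma objective_const W : objective D (fun=> W) = frob B W.
Proof. by rewrite Aadj_sum frob_suml. Qed.

Lemma edge_const (Z : 'I_N -> M) :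
  (forall i j, e i j -> Z i = Z j) -> forall i j, Z i = Z j.
Proof.
move=> Ze i j; have /connectP[p] := e_connected i j.
by elim: p i => [|k p IH] i /=; [move=> _ ->|move=> /andP[/Ze -> /IH]; apply].
Qed.

Variables (Zs : M) (c : R).
Hypotheses (FZs : F Zs) (c_gt0 : 0 < c).
Hypothesis growth : forall W, F W -> c * frob (W - Zs) (W - Zs) <= frob B (Zs - W).

Lemma frob_le_opt W : F W -> frob B W <= frob B Zs.
Proof.
move=> FW; rewrite -subr_ge0 -frobBr; apply: le_trans (growth FW).
by rewrite mulr_ge0 ?frob_ge0 ?ltW.
Qed.

Lemma frob_opt_unique W : F W -> frob B Zs <= frob B W -> W = Zs.
Proof.
move=> FW BW; apply/eqP; rewrite -subr_eq0; apply/eqP/frob_eq0.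
apply/le_anti; rewrite frob_ge0 andbT -(pmulr_rle0 _ c_gt0).
by apply: le_trans (growth FW) _; rewrite frobBr subr_le0.
Qed.

Lemma growth_scaled k W : 0 <= k -> F W ->
  k * c * frob (W - Zs) (W - Zs) <= frob (k *: B) (Zs - W).
Proof.
by move=> k0 FW; rewrite frobZl -mulrA ler_wpM2l// growth.
Qed.

(** All three formulations have as feasible set a copy of [F] on which the objective is [frob B]. *)
Lemma argmax_embedding (T : Type) (S : set T) (f : T -> R) (emb : M -> T) :
  S = emb @` F -> (forall W, f (emb W) = frob B W) ->
  argmax S f = [set emb Zs].
Proof.
move=> -> fE; apply/seteqP; split=> [_ [ [W FW <-] Wmax] /=|_ ->].
  rewrite (frob_opt_unique FW)// -!fE; apply: Wmax; exact: imageP.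
by split=> [|_ [W FW <-] ]; [exact: imageP|rewrite !fE frob_le_opt].
Qed.

Lemma consensus_feasibleE :
  consensus_feasible e = (fun W => (fun=> W) : 'I_N -> M) @` F.
Proof.
apply/seteqP; split=> [Z [FZ Ze]|_ [W FW <-] ]; last by split.
exists (Z (Ordinal N_gt0)); first exact: FZ.
by apply/funext => i; exact: edge_const.
Qed.

Lemma split_feasibleE :
  split_feasible e
  = (fun W => (fun=> W, fun=> W) : ('I_N -> M) * ('I_N -> M)) @` F.
Proof.
apply/seteqP; split=> [ [Z X] [ [/= FZ FX] ZX]|_ [W FW <-] ]; last by split=> //; split.
have XZ : X = Z by apply/funext => i; rewrite -(ZX i i (e_loops i)).
have Zconst : Z = fun=> Z (Ordinal N_gt0).
  by apply/funext => i; apply: edge_const => j k /ZX; rewrite XZ.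
by exists (Z (Ordinal N_gt0)); [exact: FZ|rewrite XZ -Zconst].
Qed.

Lemma fusion_feasibleE :
  @fusion_feasible R m N = (fun W => (fun=> W, W) : ('I_N -> M) * M) @` F.
Proof.
apply/seteqP; split=> [ [Z Z0] [ [/= FZ FZ0] ZZ0]|_ [W FW <-] ]; last by split=> //; split.
by exists Z0 => //; congr (_, _); apply/funext => i; rewrite ZZ0.
Qed.

Lemma split_saddle :
  exists Y : 'I_N -> 'I_N -> M, exists c' : R, [/\ 0 < c',
    split_dual Y,
    forall i W, F W -> c' * frob (W - Zs) (W - Zs) <=
      frob (Aadj (D i) - \sum_(j | e i j) Y i j) (Zs - W)
  & forall j W, F W -> c' * frob (W - Zs) (W - Zs) <=
      frob (\sum_(i | e i j) Y i j) (Zs - W)].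
Proof.
(* There are [2 * N] blocks, and each receives the same share [G] of [B]: row sums [Aadj (D i) - G],
   column sums [G]. *)
pose k : R := (N%:R * 2)^-1; pose G := k *: B.
have NR : 0 < N%:R :> R by rewrite ltr0n.
have k0 : 0 < k by rewrite invr_gt0 mulr_gt0.
have Gsym : symmetric_mx G by rewrite /symmetric_mx /= linearZ /= Aadj_sym.
have BG : \sum_i (Aadj (D i) - G) = \sum_(i < N) G.
  rewrite sumrB -Aadj_sum; apply/eqP; rewrite subr_eq; apply/eqP.
  rewrite sumr_const card_ord -mulrnDr -scaler_nat scalerA natrD.
  by rewrite /k mulr_natr mulr2n mulfV ?scale1r// gt_eqF// addr_gt0.
have [i|i|Y [Ysym Yrow Ycol] ] := edge_transport e_connected e_loops _ _ BG.
- by rewrite /symmetric_mx /= linearB /= Aadj_sym Gsym.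
- exact: Gsym.
exists Y, (k * c); split=> [||i W FW|j W FW].
- by rewrite mulr_gt0.
- exact: Ysym.
- rewrite Yrow subKr; exact: growth_scaled (ltW k0) FW.
- rewrite Ycol; exact: growth_scaled (ltW k0) FW.
Qed.

Lemma fusion_saddle :
  exists Y : 'I_N -> M, exists c' : R, [/\ 0 < c',
    fusion_dual Y,
    forall i W, F W -> c' * frob (W - Zs) (W - Zs) <=
      frob (Aadj (D i) - Y i) (Zs - W)
  & forall W, F W -> 2 * c' * frob (W - Zs) (W - Zs) <=
      frob (\sum_i Y i) (Zs - W)].
Proof.
(* Now [B] is shared by [N + 1] blocks, the last one being the fusion variable. *)
pose k : R := (N%:R + 1)^-1; pose G := k *: B.
have N1 : 0 < N%:R + 1 :> R by rewrite ltr_wpDl.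
have k0 : 0 < k by rewrite invr_gt0.
have Gsym : symmetric_mx G by rewrite /symmetric_mx /= linearZ /= Aadj_sym.
have BG : \sum_i (Aadj (D i) - G) = G.
  rewrite sumrB -Aadj_sum; apply/eqP; rewrite subr_eq; apply/eqP.
  rewrite sumr_const card_ord -mulrS -scaler_nat scalerA -natr1 mulfV ?scale1r//.
(* The constant is halved so that the fusion block has twice the required growth. *)
exists (fun i => Aadj (D i) - G), (k * c / 2); split=> [|i|i W FW|W FW].
- by rewrite divr_gt0 ?mulr_gt0.
- by rewrite /symmetric_mx /= linearB /= Aadj_sym Gsym.
- rewrite subKr; apply: le_trans (growth_scaled (ltW k0) FW).
  rewrite ler_wpM2r ?frob_ge0// ler_pdivrMr// ler_peMr ?ler1n//.
  by rewrite ltW// mulr_gt0.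
- rewrite BG mulrCA divff// mulr1; exact: growth_scaled (ltW k0) FW.
Qed.

Lemma split_duality :
  strong_duality (@split_domain R m N) (@split_dual R m N)
    (split_lagrangian e D) (split_feasible e) (split_objective D) /\
  exists p Y, saddle_point (@split_domain R m N) (@split_dual R m N)
    (split_lagrangian e D) p Y.
Proof.
have [Y [c' [c'0 Ysym Zgrowth Xgrowth] ] ] := split_saddle.
have growth_le A W : c' * frob (W - Zs) (W - Zs) <= frob A (Zs - W) ->
    frob A W <= frob A Zs.
  by rewrite frobBr => h; rewrite -subr_ge0; apply: le_trans h;
    rewrite mulr_ge0 ?frob_ge0 ?ltW.
(* Grouped by blocks, the Lagrangian separates and each block is maximized on its own. *)
have LE (p : ('I_N -> M) * ('I_N -> M)) : split_lagrangian e D p Y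
    = \sum_i frob (Aadj (D i) - \sum_(j | e i j) Y i j) (p.1 i)
      + \sum_j frob (\sum_(i | e i j) Y i j) (p.2 j).
  rewrite /split_lagrangian /split_objective /objective.
  under [in RHS]eq_bigr do rewrite frobBl frob_suml.
  under [X in _ = _ + X]eq_bigr do rewrite frob_suml.
  rewrite [X in _ = _ + X](exchange_big_dep xpredT)//= sumrB -addrA.
  congr (_ + _); rewrite addrC -sumrB; apply: eq_bigr => i _.
  by rewrite -sumrB; apply: eq_bigr => j _; rewrite frobBr.
have Lconst Y' W : split_lagrangian e D (fun=> W, fun=> W) Y' = frob B W.
  rewrite /split_lagrangian /split_objective objective_const.
  rewrite [X in _ + X]big1 ?addr0// => i _.
  by rewrite big1// => j _; rewrite subrr frob0r.
have [] := @saddle_strong_duality _ _ _ (@split_domain R m N) (split_feasible e)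
  (@split_dual R m N) (split_lagrangian e D) (split_objective D)
  (fun=> Zs, fun=> Zs) Y.
- by split=> i.
- by split=> //; split.
- exact: Ysym.
- by move=> Y'; rewrite Lconst /split_objective objective_const.
- move=> [Z X] [FZ FX]; rewrite /split_objective objective_const -(Lconst Y) !LE /=.
  apply: lerD; apply: ler_sum => i _; apply: growth_le.
    exact: Zgrowth.
  exact: Xgrowth.
- move=> p; rewrite split_feasibleE => -[W FW <-].
  by rewrite /split_objective !objective_const frob_le_opt.
by move=> saddle dual; split=> //; exists (fun=> Zs, fun=> Zs), Y.
Qed.

Lemma fusion_duality :
  strong_duality (@fusion_domain R m N) (@fusion_dual R m N)
    (fusion_lagrangian D) (@fusion_feasible R m N) (fusion_objective D) /\
  exists p Y, saddle_point (@fusion_domain R m N) (@fusion_dual R m N)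
    (fusion_lagrangian D) p Y.
Proof.
have [Y [c' [c'0 Ysym Zgrowth Z0growth] ] ] := fusion_saddle.
have growth_le a A W : 0 <= a -> a * frob (W - Zs) (W - Zs) <= frob A (Zs - W) ->
    frob A W <= frob A Zs.
  by rewrite frobBr => a0 h; rewrite -subr_ge0; apply: le_trans h;
    rewrite mulr_ge0 ?frob_ge0.
have LE (p : ('I_N -> M) * M) : fusion_lagrangian D p Y
    = \sum_i frob (Aadj (D i) - Y i) (p.1 i) + frob (\sum_i Y i) p.2.
  rewrite /fusion_lagrangian /fusion_objective /objective frob_suml.
  by rewrite -!big_split; apply: eq_bigr => i _ /=; rewrite frobBl frobBr; ring.
have Lconst Y' W : fusion_lagrangian D (fun=> W, W) Y' = frob B W.
  rewrite /fusion_lagrangian /fusion_objective objective_const.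
  rewrite [X in _ + X]big1 ?addr0// => i _.
  by rewrite subrr frob0r.
have [] := @saddle_strong_duality _ _ _ (@fusion_domain R m N)
  (@fusion_feasible R m N) (@fusion_dual R m N) (fusion_lagrangian D)
  (fusion_objective D) (fun=> Zs, Zs) Y.
- by split.
- by split=> //; split.
- exact: Ysym.
- by move=> Y'; rewrite Lconst /fusion_objective objective_const.
- move=> [Z Z0] [FZ FZ0]; rewrite /fusion_objective objective_const -(Lconst Y) !LE /=.
  apply: lerD; last by apply: growth_le (Z0growth _ FZ0); rewrite mulr_ge0 ?ltW.
  by apply: ler_sum => i _; apply: growth_le (ltW c'0) (Zgrowth _ _ (FZ i)).
- move=> p; rewrite fusion_feasibleE => -[W FW <-].
  by rewrite /fusion_objective !objective_const frob_le_opt.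
by move=> saddle dual; split=> //; exists (fun=> Zs, Zs), Y.
Qed.

Lemma objective_cvg (Z : nat -> 'I_N -> M) :
  (forall i, Z t i @[t --> \oo] --> Zs) ->
  objective D (Z t) @[t --> \oo] --> objective D (fun=> Zs).
Proof.
move=> Zcvg; apply: cvg_big; first exact: add_continuous.
by move=> i _; apply: (cvg_comp _ _ (Zcvg i)); exact: continuous_frob.
Qed.

Lemma distributed_admm_converges : symmetric e ->
  exists alpha : R, 0 < alpha /\
    forall Z X Y, distributed_admm e D alpha Z X Y ->
      [/\ objective D (Z t) @[t --> \oo] --> objective D (fun=> Zs),
          forall i, Z t i @[t --> \oo] --> Zs
        & forall j, X t j @[t --> \oo] --> Zs].
Proof.
move=> esym; have [Ys [c' [c'0 _ Zgrowth Xgrowth] ] ] := split_saddle.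
(* The descent holds for every positive parameter; 1 is one choice. *)
exists 1; split=> // Z X Y run.
have [Zcvg Xcvg] := distributed_admm_cvg ltr01 c'0 FZs esym Zgrowth Xgrowth run.
by split=> //; exact: objective_cvg.
Qed.

Lemma fusion_admm_converges : (forall W, F W -> 0 <= frob Zs (Zs - W)) ->
  exists alpha : R, 0 < alpha /\
    forall Z Z0 Y, fusion_admm D alpha Z Z0 Y ->
      [/\ objective D (Z t) @[t --> \oo] --> objective D (fun=> Zs),
          forall i, Z t i @[t --> \oo] --> Zs
        & Z0 t @[t --> \oo] --> Zs].
Proof.
move=> Zs_max; have [Ys [c' [c'0 _ Zgrowth Z0growth] ] ] := fusion_saddle.
have NR : 0 < N%:R :> R by rewrite ltr0n.
have alpha0 : 0 < c' / N%:R by rewrite divr_gt0.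
have Nalpha : N%:R * (c' / N%:R) <= c' by rewrite mulrC divfK// gt_eqF.
(* The largest parameter with [N%:R * alpha <= c']. *)
exists (c' / N%:R); split=> // Z Z0 Y run.
have [Zcvg Z0cvg] :=
  fusion_admm_cvg alpha0 c'0 FZs N_gt0 Nalpha Zs_max Zgrowth Z0growth run.
by split=> //; exact: objective_cvg.
Qed.

(* A linear functional attains its maximum over the convex hull at a point of
   [SO(n)]; by uniqueness of the optimizer this point is [Amap Zs]. *)
Lemma Amap_opt_SO :
  convex_hull (@special_orthogonal R m.+1) = @Amap R m @` F ->
  special_orthogonal (Amap Zs).
Proof.
move=> SPW.
have : (@Amap R m @` F) (Amap Zs) by exact: imageP.
rewrite -SPW => -[k [w [s [w0 w1 sSO ZsE] ] ] ].
have lift i : exists W, F W /\ Amap W = s i.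
  have : convex_hull (@special_orthogonal R m.+1) (s i).
    exists 1%N, (fun=> 1), (fun=> s i); split=> //; rewrite big_ord1//.
    by rewrite scale1r.
  by rewrite SPW => -[W FW <-]; exists W.
have /choice[W WP] := lift.
(* By adjointness the objective at [W i] depends only on [s i], and the average of the [s i] is
   [Amap Zs]; nonnegative deficits with zero average vanish wherever the weight is nonzero. *)
have sum0 : \sum_i w i * (frob B Zs - frob B (W i)) = 0.
  under eq_bigr do rewrite mulrBr.
  rewrite sumrB -mulr_suml w1 mul1r frob_Aadj ZsE frob_sumr; apply/eqP.
  rewrite subr_eq0; apply/eqP; apply: eq_bigr => i _.
  by rewrite frobZr frob_Aadj (WP i).2.
have [i wi] : exists i, w i != 0.
  apply: contrapT => /forallNP w_eq0; move: w1; rewrite big1 => [/esym/eqP|i _].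
    by rewrite oner_eq0.
  by apply/eqP/negPn/negP; exact: w_eq0.
have term_ge0 j : 0 <= w j * (frob B Zs - frob B (W j)).
  by rewrite mulr_ge0// subr_ge0 frob_le_opt//; case: (WP j).
have /eqP : w i * (frob B Zs - frob B (W i)) = 0.
  exact: (psumr_eq0P (fun j _ => term_ge0 j) sum0).
rewrite mulf_eq0 (negPf wi) /= subr_eq0 => /eqP BW.
by rewrite -(frob_opt_unique (WP i).1) ?BW// (WP i).2.
Qed.

End Assembly.

Theorem mainTheorem5 (R : realType) (m N : nat) (e : rel 'I_N)
    (D : 'I_N -> 'M[R]_m.+1)
    (N_gt0 : (0 < N)%N)
    (e_strongly_connected : forall i j, connect e i j)
    (e_loops : forall i, e i i)
    (SPW : convex_hull (@special_orthogonal R m.+1)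
           = @Amap R m @` @free_spectrahedron R (2 ^ m))
    (D_simple : simple_largest_eigenvalue (Aadj (\sum_i D i))) :
  exists Zstar : 'M[R]_(2 ^ m),
    [/\ [/\ argmax (consensus_feasible e) (objective D) = [set (fun=> Zstar)],
            argmax (split_feasible e) (split_objective D)
              = [set ((fun=> Zstar), (fun=> Zstar))]
          & argmax (@fusion_feasible R m N) (fusion_objective D)
              = [set ((fun=> Zstar), Zstar)]],
        [/\ closed_proper_convex_family
              (restricted_neg (@F_family R m N) (objective D)),
            closed_proper_convex_family
              (restricted_neg (@F_family R m N) (fun=> 0))
          & closed_proper_convex_mx
              (restricted_neg (@free_spectrahedron R (2 ^ m)) (fun=> 0))],
        [/\ strong_duality (@split_domain R m N) (@split_dual R m N)
              (split_lagrangian e D) (split_feasible e) (split_objective D),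
            (exists p Y, saddle_point (@split_domain R m N) (@split_dual R m N)
                           (split_lagrangian e D) p Y),
            strong_duality (@fusion_domain R m N) (@fusion_dual R m N)
              (fusion_lagrangian D) (@fusion_feasible R m N)
              (fusion_objective D)
          & (exists p Y, saddle_point (@fusion_domain R m N)
                           (@fusion_dual R m N) (fusion_lagrangian D) p Y)],
        (symmetric e ->
         exists alpha : R, 0 < alpha /\
           forall Z X Y, distributed_admm e D alpha Z X Y ->
             [/\ objective D (Z t) @[t --> \oo] --> objective D (fun=> Zstar),
                 forall i, Z t i @[t --> \oo] --> Zstar
               & forall j, X t j @[t --> \oo] --> Zstar]) /\
        (exists alpha : R, 0 < alpha /\
           forall Z Z0 Y, fusion_admm D alpha Z Z0 Y ->
             [/\ objective D (Z t) @[t --> \oo] --> objective D (fun=> Zstar),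
                 forall i, Z t i @[t --> \oo] --> Zstar
               & Z0 t @[t --> \oo] --> Zstar])
      & special_orthogonal (Amap Zstar)].
Proof.
have [Zs [c [FZs c0 growth Zs_max] ] ] :=
  spectrahedron_growth (Aadj_sym (\sum_i D i)) D_simple.
exists Zs; split.
- split.
  + exact: (argmax_embedding FZs c0 growth
      (consensus_feasibleE R m N_gt0 e_strongly_connected) (objective_const D)).
  + exact: (argmax_embedding FZs c0 growth
      (split_feasibleE R m N_gt0 e_strongly_connected e_loops) (objective_const D)).
  + exact: (argmax_embedding FZs c0 growth
      (fusion_feasibleE R m N) (objective_const D)).
- split; first exact: closed_proper_convex_objective.
    exact: closed_proper_convex_F_family.
  exact: closed_proper_convex_spectrahedron.
- have [] := split_duality N_gt0 e_strongly_connected e_loops FZs c0 growth.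
  by have [] := fusion_duality FZs c0 growth.
- split.
    exact: distributed_admm_converges growth.
  exact: (fusion_admm_converges N_gt0 FZs c0 growth).
- exact: (Amap_opt_SO FZs c0 growth).
Qed.
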